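(* Consider ${\rm APP}=\{{\rm APP}_{\infty,d}\}_{d\in\mathbb N}$ in the worst case setting for the absolute or normalized error criterion. Then for fixed $s,t>0$, EXP-$(s,t)$-WT for $\Lambda^{\rm all}$ is equivalent to EXP-$(s,t)$-WT for $\Lambda^{\rm std}$. In particular, EXP-WT for $\Lambda^{\rm all}$ is equivalent to EXP-WT for $\Lambda^{\rm std}$.
   Context: $\mathbb T^d=[0,1]^d$ is the torus with Lebesgue measure; $\hat f(\mathbf k)=\int f(\mathbf x)e^{-2\pi i\mathbf k\cdot\mathbf x}d\mathbf x$. For each $d$ let $\omega_d:\mathbb Z^d\to(0,\infty)$ with $\sum_{\mathbf k}\omega_d(\mathbf k)^{-2}<\infty$, and $H^{\omega_d}(\mathbb T^d)$ the Hilbert space of $f\in L_2(\mathbb T^d)$ with $\|f\|^2=\sum_{\mathbf k}|\hat f(\mathbf k)|^2\omega_d(\mathbf k)^2<\infty$. ${\rm APP}_{\infty,d}:H^{\omega_d}(\mathbb T^d)\to L_\infty(\mathbb T^d)$ (sup norm), $f\mapsto f$. $\Lambda^{\rm all}$: all continuous linear functionals; $\Lambda^{\rm std}$: point evaluations. $e(n,{\rm APP}_{\infty,d};\Lambda)$: infimum over algorithms $A(f)=\phi(L_1f,\dots,L_nf)$, $L_i\in\Lambda$, $\phi$ arbitrary, of $\sup_{\|f\|\le1}\|f-A(f)\|_\infty$; $e(0,{\rm APP}_{\infty,d})=\sup_{\|f\|\le1}\|f\|_\infty$. $n^\star(\varepsilon,d;\Lambda)=\inf\{n\ge0:e(n,{\rm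 APP}_{\infty,d};\Lambda)\le\varepsilon{\rm CRI}_d\}$ with ${\rm CRI}_d=1$ (ABS) or $e(0,{\rm APP}_{\infty,d})$ (NOR). EXP-$(s,t)$-WT for $\Lambda$: $\lim_{\varepsilon^{-1}+d\to\infty}\ln n^\star(\varepsilon,d;\Lambda)/((1+\ln\varepsilon^{-1})^s+d^t)=0$ ($d\in\mathbb N$, $\varepsilon\in(0,1)$). EXP-WT is EXP-$(1,1)$-WT. *)

(* Defs.v *)
From HB Require Import structures.
From mathcomp Require Import all_boot all_order all_algebra.
From mathcomp Require Import all_classical all_reals.
From mathcomp Require Import ereal esum exp trigo.
From mathcomp.real_closed Require Import complex.

Set Implicit Arguments.
Unset Strict Implicit.
Unset Printing Implicit Defensive.

Import Order.TTheory GRing.Theory Num.Theory.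
Local Open Scope ring_scope.
Local Open Scope classical_set_scope.

Section APPdefs.
Variable R : realType.

Definition Zd (d : nat) := {ffun 'I_d -> int}.
(* points of R^d; the torus T^d = [0,1]^d *)
Definition Pt (d : nat) := 'I_d -> R.
Definition cube (d : nat) : set (Pt d) := [set x | forall j, 0 <= x j <= 1].

Definition cabs (z : R[i]) : R := Normc.normc z.

(* sum of an (absolutely summable) real family over a countable index set,
   via positive and negative parts *)
Definition rsum (T : choiceType) (v : T -> R) : R :=
  fine (\esum_(k in [set: T]) (Num.max (v k) 0)%:E)
  - fine (\esum_(k in [set: T]) (Num.max (- v k) 0)%:E).
Definition csum (T : choiceType) (u : T -> R[i]) : R[i] :=
  Complex (rsum (fun k => @complex.Re R (u k))) (rsum (fun k => @complex.Im R (u k))).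

Definition dotp (d : nat) (k : Zd d) (x : Pt d) : R :=
  \sum_(j < d) (k j)%:~R * x j.
Definition ebasis (d : nat) (k : Zd d) (x : Pt d) : R[i] :=
  Complex (cos (2 * pi * dotp k x)) (sin (2 * pi * dotp k x)).

(* elements of H^omega are represented by their Fourier coefficients
   c = (\hat f(k))_k ; Seq d is the space of all coefficient families *)
Definition Seq (d : nat) := Zd d -> R[i].

Definition Hnorm2 (d : nat) (w : Zd d -> R) (c : Seq d) : \bar R :=
  \esum_(k in [set: Zd d]) ((cabs (c k)) ^+ 2 * (w k) ^+ 2)%:E.
Definition inH (d : nat) (w : Zd d -> R) (c : Seq d) : Prop :=
  (Hnorm2 w c < +oo)%E.
Definition unit_ball (d : nat) (w : Zd d -> R) : set (Seq d) :=
  [set c | (Hnorm2 w c <= 1)%E].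

Definition fval (d : nat) (c : Seq d) (x : Pt d) : R[i] :=
  csum (fun k => c k * ebasis k x).

Definition Lam_all (d : nat) (w : Zd d -> R) : set (Seq d -> R[i]) :=
  [set L | (forall (a : R[i]) (c1 c2 : Seq d), inH w c1 -> inH w c2 ->
              L (fun k => a * c1 k + c2 k) = a * L c1 + L c2)
        /\ exists M : R, forall c, inH w c ->
              cabs (L c) <= M * Num.sqrt (fine (Hnorm2 w c))].
Definition Lam_std (d : nat) : set (Seq d -> R[i]) :=
  [set L | exists x, @cube d x /\ L = fun c => fval c x].

Definition supnorm (d : nat) (h : Pt d -> R[i]) : \bar R :=
  ereal_sup [set (cabs (h x))%:E | x in @cube d].

Definition init_err (d : nat) (w : Zd d -> R) : \bar R :=
  ereal_sup [set supnorm (fval c) | c in unit_ball w].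

Definition wc_err (d n : nat) (w : Zd d -> R) (L : 'I_n -> Seq d -> R[i])
    (phi : ('I_n -> R[i]) -> Pt d -> R[i]) : \bar R :=
  ereal_sup [set supnorm (fun x => fval c x - phi (fun i => L i c) x)
            | c in unit_ball w].

Definition nth_err (d n : nat) (w : Zd d -> R) (Lam : set (Seq d -> R[i]))
    : \bar R :=
  if n == 0%N then init_err w else
  ereal_inf [set e | exists (L : 'I_n -> Seq d -> R[i])
                            (phi : ('I_n -> R[i]) -> Pt d -> R[i]),
                       (forall i, Lam (L i)) /\ e = wc_err w L phi].

Inductive crit := ABS | NOR.

Definition CRI (cr : crit) (d : nat) (w : Zd d -> R) : \bar R :=
  match cr with ABS => 1%E | NOR => init_err w end.

(* information complexity n^*(eps, d; Lambda), +oo if no n works *)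
Definition nstar (cr : crit) (d : nat) (w : Zd d -> R)
    (Lam : set (Seq d -> R[i])) (eps : R) : \bar R :=
  ereal_inf [set (n%:R)%:E | n in
     [set n : nat | (nth_err n w Lam <= eps%:E * CRI cr w)%E]].

Definition lnE (x : \bar R) : \bar R :=
  match x with
  | r%:E => (ln r)%:E
  | +oo%E => +oo%E
  | -oo%E => -oo%E
  end.

Definition EXP_WT_st (cr : crit) (w : forall d : nat, Zd d -> R)
    (Lam : forall d : nat, set (Seq d -> R[i])) (s t : R) : Prop :=
  forall delta : R, 0 < delta -> exists N : R,
    forall (d : nat) (eps : R), (0 < d)%N -> 0 < eps < 1 ->
      N < eps^-1 + d%:R ->
      (`| lnE (nstar cr (w d) (Lam d) eps)
          * (((1 + ln eps^-1) `^ s + d%:R `^ t) ^-1)%:E | <= delta%:E)%E.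

Definition EXP_WT (cr : crit) (w : forall d : nat, Zd d -> R)
    (Lam : forall d : nat, set (Seq d -> R[i])) : Prop :=
  EXP_WT_st cr w Lam 1 1.

End APPdefs.

(* Main.v *)
(* Write sigma_k = 1/w(k), let s be a set of n frequencies with the largest sigma_k,
   and let T^2 be the sum of sigma_k^2 over k outside s.
   For arbitrary linear information the n-th minimal error is at least T: project
   (sigma_k e_k(-x))_k onto the annihilator of the n functionals; averaging the squared
   norm of the projection over a fine grid of x gives a trace, which loses at most the n
   largest terms, so for some x the projected vector gives a fooling function.
   For function values, sample along the multiples j.alpha, j < m = 20 n^3, where alpha is
   a grid point such that the numbers e(k.alpha), k in s, are 1/(5n^2)-separated.  The
   Dirichlet kernel of length m is then nearly diagonal on s, so a Fourier series with
   vanishing samples has l1-norm on s bounded by a constant times its l1-norm outside s.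
   Hence any interpolant in the unit ball has uniform error at most 20 T.
   So sampling needs at most 20 n^3 points where n functionals suffice for error eps/20,
   and neither the cube nor the constants affect the logarithmic quotient. *)
Require Import Defs.
From HB Require Import structures.
From mathcomp Require Import all_boot all_order all_algebra.
From mathcomp Require Import all_classical all_reals.
From mathcomp Require Import ereal esum exp trigo.
From mathcomp.real_closed Require Import complex.
From mathcomp Require finmap.
From mathcomp Require Import ring lra zify.
Import Order.TTheory GRing.Theory Num.Theory.
Local Open Scope ring_scope.
Local Open Scope classical_set_scope.

(** * Unconditional sums of real families over a countable index set *)

Section RealSums.
Variables (R : realType) (T : choiceType).
Implicit Types (a b v : T -> R) (s : seq T).

Definition esumr a : \bar R := (\esum_(k in [set: T]) (a k)%:E)%E.
Definition tsum a : R := fine (esumr a).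
Definition summ v : Prop := (esumr (fun k => `|v k|%R) < +oo)%E.

Lemma esumr_ge0 a : (forall k, 0 <= a k) -> (0 <= esumr a)%E.
Proof. by move=> a0; apply: esum_ge0 => k _; rewrite lee_fin. Qed.

Lemma le_esumr {a b} : (forall k, a k <= b k) -> (esumr a <= esumr b)%E.
Proof. by move=> ab; apply: le_esum => k _; rewrite lee_fin. Qed.

Lemma esumr_seq a s : uniq s -> (forall k, 0 <= a k) ->
  (forall k, k \notin s -> a k = 0) -> esumr a = (\sum_(k <- s) a k)%:E.
Proof.
move=> us a0 as0.
have -> : esumr a = (\esum_(k in [set` s]) (a k)%:E)%E.
  rewrite esum_mkcond; apply: eq_esum => k _.
  by case: ifPn => //; rewrite mem_setE => /as0 ->.
rewrite esum_fset; last 2 first.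
- exact: finite_seq.
- by move=> k _; rewrite lee_fin.
by rewrite -fsbig_seq// sumEFin.
Qed.

Lemma esumr_le a (M : R) :
  (forall s, uniq s -> \sum_(k <- s) a k <= M) -> (esumr a <= M%:E)%E.
Proof.
move=> h; apply: ge_ereal_sup => _ [X [finX _] <-].
by rewrite fsbig_finite//= sumEFin lee_fin; apply: h; exact: finmap.fset_uniq.
Qed.

Lemma le_esumr_seq a s : (forall k, 0 <= a k) -> uniq s ->
  ((\sum_(k <- s) a k)%:E <= esumr a)%E.
Proof.
move=> a0 us; apply: esum_ge; exists [set` s].
  by split => //; exact: finite_seq.
by rewrite -fsbig_seq// sumEFin.
Qed.

Lemma esumr_fin_num a : (forall k, 0 <= a k) -> (esumr a < +oo)%E ->
  esumr a \is a fin_num.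
Proof. by move=> a0 ?; rewrite ge0_fin_numE// esumr_ge0. Qed.

Lemma esumrD a b : (forall k, 0 <= a k) -> (forall k, 0 <= b k) ->
  (esumr (fun k => (a k + b k)%R) = esumr a + esumr b)%E.
Proof.
move=> a0 b0; rewrite /esumr -esumD; last 2 first.
- by move=> k _; rewrite lee_fin.
- by move=> k _; rewrite lee_fin.
by apply: eq_esum => k _; rewrite EFinD.
Qed.

Lemma esumrZ (r : R) a : 0 <= r -> (forall k, 0 <= a k) ->
  (esumr (fun k => (r * a k)%R) = r%:E * esumr a)%E.
Proof.
have ub (q : R) b : 0 <= q -> (forall k, 0 <= b k) ->
    (esumr (fun k => (q * b k)%R) <= q%:E * esumr b)%E.
  move=> q0 b0; apply: ge_ereal_sup => _ [X [finX _] <-].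
  rewrite fsbig_finite//= sumEFin -mulr_sumr EFinM.
  by apply: lee_wpmul2l; rewrite ?lee_fin// le_esumr_seq// finmap.fset_uniq.
move=> r0 a0; apply/eqP; rewrite eq_le ub//=.
have [<-|rn0] := eqVneq 0 r.
  by rewrite mul0e esumr_ge0// => k; rewrite mul0r.
have {rn0} r1 : 0 < r by rewrite lt_neqAle rn0.
rewrite -lee_pdivlMl//.
(* The reverse inequality is the same bound for the factor [r^-1] and the family [r * a k]. *)
apply: le_trans (ub _ _ _ _); last 2 first.
- by rewrite invr_ge0.
- by move=> k; rewrite mulr_ge0.
by apply: le_esumr => k; rewrite mulKf// gt_eqF.
Qed.

Lemma tsum_ge0 a : (forall k, 0 <= a k) -> 0 <= tsum a.
Proof. by move=> a0; rewrite /tsum fine_ge0// esumr_ge0. Qed.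

Lemma summ_ge0 a : (forall k, 0 <= a k) -> summ a <-> (esumr a < +oo)%E.
Proof.
move=> a0; rewrite /summ; have -> // : esumr (fun k => `|a k|) = esumr a.
by apply: eq_esum => k _; rewrite ger0_norm.
Qed.

Lemma summ_le v a : summ a -> (forall k, `|v k| <= `|a k|) -> summ v.
Proof. by move=> sa va; apply: le_lt_trans sa; exact: le_esumr. Qed.

Lemma tsumK a : (forall k, 0 <= a k) -> summ a -> (tsum a)%:E = esumr a.
Proof. by move=> a0 /(summ_ge0 a a0) sa; rewrite fineK// esumr_fin_num. Qed.

Lemma summ_norm v : summ v -> summ (fun k => `|v k|).
Proof. by move=> sv; apply: summ_le sv _ => k; rewrite normr_id. Qed.

Lemma le_tsum a b : (forall k, 0 <= a k) -> summ b -> (forall k, a k <= b k) ->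
  tsum a <= tsum b.
Proof.
move=> a0 sb ab; have b0 k : 0 <= b k by rewrite (le_trans (a0 k)).
rewrite -lee_fin !tsumK//; first exact: le_esumr.
by apply: summ_le sb _ => k; rewrite !ger0_norm.
Qed.

Lemma summD v v' : summ v -> summ v' -> summ (fun k => v k + v' k).
Proof.
move=> sv sv'; rewrite /summ; apply: le_lt_trans (lte_add_pinfty sv sv').
by rewrite -esumrD//; apply: le_esumr => k; exact: ler_normD.
Qed.

Lemma summZ (r : R) v : summ v -> summ (fun k => r * v k).
Proof.
move=> sv; rewrite /summ; have -> : (fun k => `|r * v k|) = (fun k => `|r| * `|v k|).
  by apply/funext => k; rewrite normrM.
by rewrite esumrZ// -tsumK//; [rewrite -EFinM ltry | exact: summ_norm].
Qed.

Lemma tsumD a b : (forall k, 0 <= a k) -> (forall k, 0 <= b k) ->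
  summ a -> summ b -> tsum (fun k => a k + b k) = tsum a + tsum b.
Proof.
move=> a0 b0 sa sb; apply: EFin_inj; rewrite EFinD !tsumK// ?esumrD//.
- by move=> k; rewrite addr_ge0.
- exact: summD.
Qed.

Lemma tsumZ (r : R) a : 0 <= r -> (forall k, 0 <= a k) -> summ a ->
  tsum (fun k => r * a k) = r * tsum a.
Proof.
move=> r0 a0 sa; apply: EFin_inj; rewrite EFinM !tsumK// ?esumrZ//.
- by move=> k; rewrite mulr_ge0.
- exact: summZ.
Qed.

Lemma summ_seq v s : (forall k, k \notin s -> v k = 0) -> summ v.
Proof.
move=> vs; rewrite /summ (esumr_seq _ (undup s)) ?undup_uniq ?ltry//.
by move=> k; rewrite mem_undup => /vs ->; rewrite normr0.
Qed.

Lemma le_tsum_seq a s : (forall k, 0 <= a k) -> summ a -> uniq s ->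
  \sum_(k <- s) a k <= tsum a.
Proof. by move=> a0 sa us; rewrite -lee_fin tsumK// le_esumr_seq. Qed.

Lemma summ_sum (I : eqType) (r : seq I) (F : I -> T -> R) :
  (forall i, i \in r -> summ (F i)) -> summ (fun k => \sum_(i <- r) F i k).
Proof.
elim: r => [|i r IH] h.
  by apply: (@summ_seq _ [::]) => k _; rewrite big_nil.
have -> : (fun k => \sum_(j <- i :: r) F j k) = (fun k => F i k + \sum_(j <- r) F j k).
  by apply/funext => k; rewrite big_cons.
apply: summD; first by apply: h; rewrite mem_head.
by apply: IH => j jr; apply: h; rewrite inE jr orbT.
Qed.

Lemma tsum_sum (I : eqType) (r : seq I) (F : I -> T -> R) :
  (forall i k, 0 <= F i k) -> (forall i, i \in r -> summ (F i)) ->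
  tsum (fun k => \sum_(i <- r) F i k) = \sum_(i <- r) tsum (F i).
Proof.
move=> F0; elim: r => [|i r IH] h.
  rewrite big_nil; apply: EFin_inj.
  rewrite tsumK; last 2 first.
  - by move=> k; rewrite big_nil.
  - by apply: (@summ_seq _ [::]) => k _; rewrite big_nil.
  by rewrite (esumr_seq _ [::]) ?big_nil// => k; rewrite big_nil.
have hr j : j \in r -> summ (F j) by move=> jr; apply: h; rewrite inE jr orbT.
rewrite big_cons -IH// -tsumD//.
- by congr tsum; apply/funext => k; rewrite big_cons.
- by move=> k; apply: sumr_ge0.
- by apply: h; rewrite mem_head.
- exact: summ_sum.
Qed.

(* [rsum] may be computed from any decomposition of the family as a difference
   of summable nonnegative families, not just the positive and negative parts. *)
Lemma rsum_diff a b v : (forall k, 0 <= a k) -> (forall k, 0 <= b k) ->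
  summ a -> summ b -> (forall k, v k = a k - b k) -> rsum v = tsum a - tsum b.
Proof.
move=> a0 b0 sa sb vab.
have -> : rsum v = tsum (fun k => Num.max (v k) 0) - tsum (fun k => Num.max (- v k) 0).
  by [].
have p0 k : 0 <= Num.max (v k) 0 by rewrite le_max lexx orbT.
have n0 k : 0 <= Num.max (- v k) 0 by rewrite le_max lexx orbT.
have sp : summ (fun k => Num.max (v k) 0).
  apply: summ_le sa _ => k; rewrite !ger0_norm// ge_max a0 andbT vab.
  by rewrite lerBlDr lerDl.
have sn : summ (fun k => Num.max (- v k) 0).
  apply: summ_le sb _ => k; rewrite !ger0_norm// ge_max b0 andbT vab opprB.
  by rewrite lerBlDr lerDl.
(* Moving the subtracted sums across leaves an equality of sums of nonnegative families, which holds
   term by term. *)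
apply/eqP; rewrite subr_eq addrAC eq_sym subr_eq -!tsumD//.
apply/eqP; congr tsum; apply/funext => k; rewrite vab.
by case: (leP (a k - b k) 0) => h; case: (leP (- (a k - b k)) 0) => h'; lra.
Qed.

Lemma rsum_lin (r : R) v v' : summ v -> summ v' ->
  rsum (fun k => r * v k + v' k) = r * rsum v + rsum v'.
Proof.
move=> sv sv'.
(* Positive and negative parts, in a form that makes every pointwise identity below linear in
   [|u k|] and [u k]. *)
pose p (u : T -> R) k := (`|u k| + u k) / 2.
pose q (u : T -> R) k := (`|u k| - u k) / 2.
have hn (x : R) : - x <= `|x| /\ x <= `|x|.
  by split; [rewrite -normrN|]; exact: ler_norm.
have p0 u k : 0 <= p u k by rewrite divr_ge0//; have := hn (u k); lra.
have q0 u k : 0 <= q u k by rewrite divr_ge0//; have := hn (u k); lra.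
have sp u : summ u -> summ (p u).
  move=> su; apply: summ_le su _ => k; rewrite ger0_norm//.
  by rewrite /p; have := hn (u k); lra.
have sq u : summ u -> summ (q u).
  move=> su; apply: summ_le su _ => k; rewrite ger0_norm//.
  by rewrite /q; have := hn (u k); lra.
have pq u k : u k = p u k - q u k by rewrite /p /q; field.
rewrite (rsum_diff _ _ _ (p0 v) (q0 v) (sp _ sv) (sq _ sv) (pq v)).
rewrite (rsum_diff _ _ _ (p0 v') (q0 v') (sp _ sv') (sq _ sv') (pq v')).
have comb (t : R) a b : 0 <= t -> (forall k, 0 <= a k) -> (forall k, 0 <= b k) ->
    summ a -> summ b ->
    [/\ forall k, 0 <= t * a k + b k, summ (fun k => t * a k + b k) &
        tsum (fun k => t * a k + b k) = t * tsum a + tsum b].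
  move=> t0 a0 b0 sa sb; split.
  - by move=> k; rewrite addr_ge0// mulr_ge0.
  - by apply: summD => //; exact: summZ.
  - rewrite tsumD//; [by rewrite tsumZ | | exact: summZ].
    by move=> k; rewrite mulr_ge0.
have [r0|r0] := leP 0 r.
  have [h1 h2 h3] := comb _ _ _ r0 (p0 v) (p0 v') (sp _ sv) (sp _ sv').
  have [h4 h5 h6] := comb _ _ _ r0 (q0 v) (q0 v') (sq _ sv) (sq _ sv').
  rewrite (rsum_diff _ _ _ h1 h4 h2 h5) ?h3 ?h6; first by ring.
  by move=> k; rewrite {1}(pq v) {1}(pq v'); ring.
(* For negative [r] the two parts of [v] exchange roles: [r * v = (- r) * q v - (- r) * p v]. *)
have {}r0 : 0 <= - r by rewrite oppr_ge0 ltW.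
have [h1 h2 h3] := comb _ _ _ r0 (q0 v) (p0 v') (sq _ sv) (sp _ sv').
have [h4 h5 h6] := comb _ _ _ r0 (p0 v) (q0 v') (sp _ sv) (sq _ sv').
rewrite (rsum_diff _ _ _ h1 h4 h2 h5) ?h3 ?h6; first by ring.
by move=> k; rewrite {1}(pq v) {1}(pq v'); ring.
Qed.

Lemma rsum_abs v : summ v -> `|rsum v| <= tsum (fun k => `|v k|).
Proof.
move=> sv.
have hn (x : R) : - x <= `|x| /\ x <= `|x|.
  by split; [rewrite -normrN|]; exact: ler_norm.
pose p k := (`|v k| + v k) / 2.
pose q k := (`|v k| - v k) / 2.
have p0 k : 0 <= p k by rewrite divr_ge0//; have := hn (v k); lra.
have q0 k : 0 <= q k by rewrite divr_ge0//; have := hn (v k); lra.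
have sp : summ p.
  by apply: summ_le sv _ => k; rewrite ger0_norm// /p; have := hn (v k); lra.
have sq : summ q.
  by apply: summ_le sv _ => k; rewrite ger0_norm// /q; have := hn (v k); lra.
rewrite (rsum_diff p q)//; last by move=> k; rewrite /p /q; field.
rewrite (_ : (fun k => _) = (fun k => p k + q k)); last first.
  by apply/funext => k; rewrite /p /q; field.
rewrite tsumD//; have := tsum_ge0 _ p0; have := tsum_ge0 _ q0.
by move=> ? ?; rewrite ler_norml; lra.
Qed.

Lemma rsum_seq v s : uniq s -> (forall k, k \notin s -> v k = 0) ->
  rsum v = \sum_(k <- s) v k.
Proof.
move=> us vs; pose q k := Num.max (- v k) 0; pose p k := Num.max (v k) 0.
have p0 k : 0 <= p k by rewrite le_max lexx orbT.
have q0 k : 0 <= q k by rewrite le_max lexx orbT.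
have ps k : k \notin s -> p k = 0 by move=> /vs h; rewrite /p h maxxx.
have qs k : k \notin s -> q k = 0 by move=> /vs h; rewrite /q h oppr0 maxxx.
have -> : rsum v = tsum p - tsum q by [].
rewrite /tsum (esumr_seq _ s us p0 ps) (esumr_seq _ s us q0 qs)/= -sumrB.
apply: eq_bigr => k _; rewrite /p /q.
by case: (leP (v k) 0) => h; case: (leP (- v k) 0) => h'; lra.
Qed.

End RealSums.

(** * The real-valued modulus of complex numbers *)

Section ComplexModulus.
Variable R : realType.
Implicit Types z : R[i].

Lemma cabsE z : (cabs z)%:C%C = `|z|.
Proof. by case: z. Qed.

Lemma cabs_ge0 z : 0 <= cabs z.
Proof. by case: z => x y; exact: sqrtr_ge0. Qed.

Lemma cabsM z1 z2 : cabs (z1 * z2) = cabs z1 * cabs z2.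
Proof. exact: Normc.normcM. Qed.

Lemma cabsD z1 z2 : cabs (z1 + z2) <= cabs z1 + cabs z2.
Proof. exact: le_normcD. Qed.

Lemma cabsN z : cabs (- z) = cabs z.
Proof. exact: normcN. Qed.

Lemma cabs0 : cabs (0 : R[i]) = 0.
Proof. exact: Normc.normc0. Qed.

Lemma cabs1 : cabs (1 : R[i]) = 1.
Proof. exact: Normc.normc1. Qed.

Lemma cabsV z : cabs z^-1 = (cabs z)^-1.
Proof. exact: Normc.normcV. Qed.

Lemma cabs_real (x : R) : cabs x%:C%C = `|x|.
Proof. by rewrite /cabs /= expr0n /= addr0 sqrtr_sqr. Qed.

Lemma cabs_sqr z : ((cabs z) ^+ 2)%:C%C = z * (z^*)%C.
Proof. by rewrite rmorphXn /= cabsE sqr_normc. Qed.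

Lemma cabsB z1 z2 : cabs (z1 - z2) <= cabs z1 + cabs z2.
Proof. by rewrite (le_trans (cabsD _ _))// cabsN. Qed.

Lemma cabs_sum (I : Type) (r : seq I) (P : pred I) (F : I -> R[i]) :
  cabs (\sum_(i <- r | P i) F i) <= \sum_(i <- r | P i) cabs (F i).
Proof.
elim/big_rec2: _ => [|i y x _ xy]; first by rewrite cabs0.
by rewrite (le_trans (cabsD _ _))// lerD2l.
Qed.

Lemma Re_le_cabs z : `|complex.Re z| <= cabs z.
Proof. by rewrite -lecR cabsE normc_ge_Re. Qed.

Lemma Im_le_cabs z : `|complex.Im z| <= cabs z.
Proof.
case: z => x y /=; rewrite /cabs /= -[`|y|]sqrtr_sqr ler_sqrt.
  by rewrite lerDr sqr_ge0.
by rewrite addr_ge0// sqr_ge0.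
Qed.

Lemma cabs_le_ReIm z : cabs z <= `|complex.Re z| + `|complex.Im z|.
Proof.
case: z => x y /=; rewrite /cabs /= -[leRHS]ger0_norm ?addr_ge0//.
rewrite -sqrtr_sqr ler_sqrt ?sqr_ge0// sqrrD !real_normK ?num_real//.
by rewrite addrAC lerDl mulrn_wge0// mulr_ge0.
Qed.

End ComplexModulus.

(** * Absolutely summable complex families *)

Section ComplexSums.
Variables (R : realType) (T : choiceType).
Implicit Types (u v : T -> R[i]) (s : seq T).

Definition csumm u : Prop := summ R T (fun k => cabs (u k)).

Lemma csumm_le u v : csumm v -> (forall k, cabs (u k) <= cabs (v k)) -> csumm u.
Proof. by move=> sv uv; apply: summ_le sv _ => k; rewrite !ger0_norm ?cabs_ge0. Qed.

Lemma csumm_Re u : csumm u -> summ R T (fun k => complex.Re (u k)).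
Proof.
by move=> su; apply: summ_le su _ => k; rewrite [leRHS]ger0_norm ?cabs_ge0// Re_le_cabs.
Qed.

Lemma csumm_Im u : csumm u -> summ R T (fun k => complex.Im (u k)).
Proof.
by move=> su; apply: summ_le su _ => k; rewrite [leRHS]ger0_norm ?cabs_ge0// Im_le_cabs.
Qed.

Lemma csummZ (a : R[i]) u : csumm u -> csumm (fun k => a * u k).
Proof.
move=> su; rewrite /csumm (_ : (fun k => _) = (fun k => cabs a * cabs (u k))).
  exact: summZ.
by apply/funext => k; rewrite cabsM.
Qed.

Lemma csummD u v : csumm u -> csumm v -> csumm (fun k => u k + v k).
Proof.
move=> su sv; apply: summ_le (summD _ _ _ _ su sv) _ => k.
by rewrite !ger0_norm ?addr_ge0 ?cabs_ge0// cabsD.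
Qed.

Lemma csumm_lin (a : R[i]) u v : csumm u -> csumm v ->
  csumm (fun k => a * u k + v k).
Proof. by move=> su sv; apply: csummD => //; exact: csummZ. Qed.

Lemma csumm_seq u s : (forall k, k \notin s -> u k = 0) -> csumm u.
Proof. by move=> us; apply: (@summ_seq _ _ _ s) => k /us ->; rewrite cabs0. Qed.

Lemma csum_lin (a : R[i]) u v : csumm u -> csumm v ->
  csum (fun k => a * u k + v k) = a * csum u + csum v.
Proof.
move=> su sv; case: a => a b; rewrite /csum.
have [ru iu rv iv] : [/\ summ R T (fun k => complex.Re (u k)),
  summ R T (fun k => complex.Im (u k)), summ R T (fun k => complex.Re (v k)) &
  summ R T (fun k => complex.Im (v k))].
  by split; [exact: csumm_Re|exact: csumm_Im|exact: csumm_Re|exact: csumm_Im].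
apply/eqP; rewrite eq_complex /=; apply/andP; split; apply/eqP.
- rewrite (_ : (fun k => _) = (fun k => a * complex.Re (u k)
      + ((- b) * complex.Im (u k) + complex.Re (v k)))); last first.
    by apply/funext => k; case: (u k) (v k) => ? ? [? ?] /=; ring.
  rewrite !rsum_lin//; first by ring.
  by apply: summD => //; exact: summZ.
- rewrite (_ : (fun k => _) = (fun k => a * complex.Im (u k)
      + (b * complex.Re (u k) + complex.Im (v k)))); last first.
    by apply/funext => k; case: (u k) (v k) => ? ? [? ?] /=; ring.
  rewrite !rsum_lin//; first by ring.
  by apply: summD => //; exact: summZ.
Qed.

(** Real and imaginary parts are bounded separately, whence the factor 2; it only enters the
    absolute constant 20 of the final comparison. *)
Lemma cabs_csum u : csumm u -> cabs (csum u) <= 2 * tsum R T (fun k => cabs (u k)).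
Proof.
move=> su; rewrite (le_trans (cabs_le_ReIm _ _))//= mulr2n mulrDl mul1r.
apply: lerD; (apply: le_trans; first apply: rsum_abs).
- exact: csumm_Re.
- by apply: le_tsum => // k; rewrite Re_le_cabs.
- exact: csumm_Im.
- by apply: le_tsum => // k; rewrite Im_le_cabs.
Qed.

Lemma csum_seq u s : uniq s -> (forall k, k \notin s -> u k = 0) ->
  csum u = \sum_(k <- s) u k.
Proof.
move=> us h; rewrite /csum (rsum_seq _ _ _ s)//; last by move=> k /h ->.
rewrite (rsum_seq _ _ _ s)//; last by move=> k /h ->.
elim: {us h} s => [|k s IH]; first by rewrite !big_nil.
by rewrite !big_cons -IH; case: (u k).
Qed.

Lemma csum0 : csum (fun _ : T => 0 : R[i]) = 0.
Proof. by rewrite (csum_seq _ [::])// big_nil. Qed.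

Lemma csum_sum (I : eqType) (r : seq I) (F : I -> T -> R[i]) (a : I -> R[i]) :
  (forall i, csumm (F i)) ->
  csumm (fun k => \sum_(i <- r) a i * F i k) /\
  csum (fun k => \sum_(i <- r) a i * F i k) = \sum_(i <- r) a i * csum (F i).
Proof.
move=> h; elim: r => [|i r [IH1 IH2]].
  rewrite (_ : (fun k => _) = fun=> 0); last by apply/funext => k; rewrite big_nil.
  by rewrite csum0 big_nil; split => //; apply: (@csumm_seq _ [::]).
rewrite (_ : (fun k => _) = (fun k => a i * F i k + \sum_(j <- r) a j * F j k)).
  by rewrite csum_lin// IH2 big_cons; split => //; exact: csumm_lin.
by apply/funext => k; rewrite big_cons.
Qed.

End ComplexSums.

(** * Characters, orthogonality on grids, and the Dirichlet kernel *)

Section Exponentials.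
Variable R : realType.

(** This is $e^{2\pi i x}$; [ebasis k x] is convertible to [cexp (dotp k x)]. *)
Definition cexp (x : R) : R[i] := Complex (cos (2 * pi * x)) (sin (2 * pi * x)).

Lemma cexpD x y : cexp (x + y) = cexp x * cexp y.
Proof.
by apply/eqP; rewrite eq_complex /= mulrDr cosD sinD addrC [X in _ && (_ == X)]addrC !eqxx.
Qed.

Lemma cexp0 : cexp 0 = 1.
Proof. by apply/eqP; rewrite eq_complex /= mulr0 cos0 sin0 !eqxx. Qed.

Lemma cexpN x : cexp (- x) = (cexp x)^*%C.
Proof. by rewrite /cexp mulrN cosN sinN. Qed.

Lemma cabs_cexp x : cabs (cexp x) = 1.
Proof. by rewrite /cabs /= cos2Dsin2 sqrtr1. Qed.

Lemma cexp_sum (I : Type) (r : seq I) (F : I -> R) :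
  cexp (\sum_(i <- r) F i) = \prod_(i <- r) cexp (F i).
Proof. by elim/big_rec2: _ => [|i y x _ <-]; rewrite ?cexp0 ?cexpD. Qed.

Lemma cexpMn x n : cexp (n%:R * x) = cexp x ^+ n.
Proof.
elim: n => [|n IH]; first by rewrite mul0r cexp0 expr0.
by rewrite -natr1 mulrDl mul1r cexpD IH exprSr.
Qed.

Lemma cexp_nat n : cexp n%:R = 1.
Proof.
rewrite -[n%:R]mulr1 cexpMn (_ : cexp 1 = 1) ?expr1n//.
by apply/eqP; rewrite eq_complex /= mulr1 mulr_natl cos2pi sin2pi !eqxx.
Qed.

Lemma cexp_int (z : int) : cexp z%:~R = 1.
Proof.
case: z => n; first exact: cexp_nat.
by rewrite NegzE mulrNz cexpN -pmulrn cexp_nat conjc1.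
Qed.

(** The real part is $1 - 2\sin^2(\pi x)$, and the sine is positive on $(0,\pi)$. *)
Lemma cexp_neq1 x : 0 < x < 1 -> cexp x != 1.
Proof.
move=> /andP[x0 x1]; apply/eqP => /(congr1 (@complex.Re R)) /= h.
have s0 : 0 < sin (pi * x).
  by apply: sin_gt0_pi; rewrite mulr_gt0 ?pi_gt0//= gtr_pMr ?pi_gt0.
have : cos (2 * pi * x) = 1 - 2 * sin (pi * x) ^+ 2.
  rewrite -mulrA mulr_natl cos_mulr2n sin2cos2; ring.
rewrite h => /eqP; rewrite -subr_eq0 opprB addrC subrK.
by rewrite mulf_eq0 pnatr_eq0/= expf_eq0/= gt_eqF.
Qed.

Lemma cexp_frac_neq1 (u : int) (M : nat) : u != 0 -> (`|u| < M)%N ->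
  cexp (u%:~R / M%:R) != 1.
Proof.
have pos (n : nat) : (0 < n < M)%N -> cexp (n%:R / M%:R) != 1.
  move=> /andP[n0 nM]; have M0 : (0 < M)%N by exact: leq_ltn_trans nM.
  by rewrite cexp_neq1// divr_gt0 ?ltr0n//= ltr_pdivrMr ?ltr0n// mul1r ltr_nat.
case: u => n; first by rewrite /= => n0 nM; rewrite pos//= nM andbT lt0n.
rewrite NegzE /= mulrNz mulNr cexpN => _ nM.
rewrite -pmulrn; apply: contraNN (pos n.+1 nM) => /eqP h.
by rewrite -[X in X == _]conjcK h conjc1.
Qed.

Lemma cexp_geom (u : int) (M : nat) : u != 0 -> (`|u| < M)%N ->
  \sum_(a < M) cexp (a%:R * (u%:~R / M%:R)) = 0.
Proof.
move=> u0 uM; have := subrX1 (cexp (u%:~R / M%:R)) M.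
rewrite -cexpMn mulrC divfK; last by rewrite pnatr_eq0 -lt0n (leq_ltn_trans _ uM).
rewrite cexp_int subrr => /esym/eqP; rewrite mulf_eq0 subr_eq0.
rewrite (negbTE (cexp_frac_neq1 _ _ u0 uM))/= => /eqP h.
by rewrite -[RHS]h; apply: eq_bigr => a _; rewrite cexpMn.
Qed.

Definition grid (d M : nat) : finType := {ffun 'I_d -> 'I_M}.

(** The inner product of [v] with the grid point [z / M], not reduced modulo 1. *)
Definition phase (d M : nat) (v : Zd d) (z : grid d M) : R :=
  \sum_(i < d) (z i)%:R * ((v i)%:~R / M%:R).

(** The sum factors over the coordinates. At a coordinate with [v i != 0] the factor is a full
    geometric sum of a root of unity, different from 1 because [M] exceeds [|v i|]. *)
Lemma grid_orthogonality (d M : nat) (v : Zd d) : v != 0 ->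
  (forall i, (`|v i| < M)%N) -> \sum_(z : grid d M) cexp (phase d M v z) = 0.
Proof.
move=> v0 vM.
under eq_bigr do rewrite /phase cexp_sum.
rewrite -(bigA_distr_bigA (fun i (a : 'I_M) => cexp (a%:R * ((v i)%:~R / M%:R)))) /=.
have [i vi] : exists i, v i != 0.
  apply/existsP; apply: contraNT v0; rewrite negb_exists => /forallP h.
  by apply/eqP/ffunP => i; rewrite ffunE; apply/eqP; rewrite -[_ == _]negbK h.
by rewrite (bigD1 i)//= cexp_geom// mul0r.
Qed.

(* The [j]-th multiple of [z / M], reduced modulo 1. *)
Definition gridpt (d M : nat) (z : grid d M) (j : nat) : Pt R d :=
  fun i => ((j * z i) %% M)%N%:R / M%:R.

Lemma gridpt_cube (d M : nat) (z : grid d M) j : cube (gridpt d M z j).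
Proof.
move=> i; rewrite /gridpt; have M0 : (0 < M)%N by case: (M) (z i) => [[]|].
rewrite divr_ge0//= ler_pdivrMr ?ltr0n// mul1r ler_nat.
by rewrite ltnW// ltn_mod.
Qed.

(** Reduction modulo 1 keeps the sampling points in the cube and changes the inner product with an
    integer frequency by an integer only. *)
Lemma ebasis_gridpt (d M : nat) (k : Zd d) (z : grid d M) j :
  ebasis k (gridpt d M z j) = cexp (j%:R * phase d M k z).
Proof.
rewrite -[LHS]/(cexp (dotp k (gridpt d M z j))) /dotp /phase mulr_sumr.
rewrite !cexp_sum; apply: eq_bigr => i _; rewrite /gridpt.
have M0 : M%:R != 0 :> R by rewrite pnatr_eq0; case: (M) (z i) => [[]|].
have -> : j%:R * ((z i)%:R * ((k i)%:~R / M%:R)) =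
   (k i)%:~R * ((j * z i %% M)%N%:R / M%:R) +
   (k i * (j * z i %/ M)%N)%:~R :> R.
  rewrite mulrA -natrM {1}(divn_eq (j * z i) M) natrD natrM.
  by rewrite intrM -pmulrn; field.
by rewrite cexpD cexp_int mulr1.
Qed.

Lemma phaseZ (d M : nat) (a : int) (v : Zd d) (z : grid d M) :
  phase d M [ffun i => a * v i] z = a%:~R * phase d M v z.
Proof.
rewrite /phase mulr_sumr; apply: eq_bigr => i _; rewrite ffunE intrM.
by rewrite -mulrA mulrCA.
Qed.

Lemma phaseB (d M : nat) (v v' : Zd d) (z : grid d M) :
  phase d M (v - v') z = phase d M v z - phase d M v' z.
Proof.
rewrite /phase -sumrB; apply: eq_bigr => i _; rewrite !ffunE intrD mulrNz.
by rewrite mulrDl mulNr mulrBr.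
Qed.

Definition dirichlet (m : nat) (x : R) : R[i] :=
  m%:R^-1 * \sum_(j < m) cexp (j%:R * x).

Lemma cabs_nat n : cabs (n%:R : R[i]) = n%:R.
Proof. by rewrite -(rmorph_nat (@real_complex_def R (Phant R))) cabs_real ger0_norm. Qed.

Lemma cabs_dirichlet_le1 m x : cabs (dirichlet m x) <= 1.
Proof.
rewrite /dirichlet cabsM cabsV cabs_nat.
have [->|m0] := posnP m; first by rewrite invr0 mul0r.
rewrite ler_pdivrMl ?ltr0n// mulr1 (le_trans (cabs_sum _ _ _ _ _))//.
by under eq_bigr do rewrite cabs_cexp; rewrite sumr_const card_ord.
Qed.

(** The geometric sum telescopes to $1 - e(mx)$, of modulus at most 2. The product form also covers
    [cexp x = 1]. *)
Lemma cabs_dirichlet_decay m x : (0 < m)%N ->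
  cabs (dirichlet m x) * cabs (1 - cexp x) <= 2 / m%:R.
Proof.
move=> m0; rewrite -cabsM /dirichlet -mulrA cabsM cabsV cabs_nat mulrC.
rewrite ler_pdivrMr ?ltr0n// divfK ?pnatr_eq0 -?lt0n//.
rewrite mulrC -[1 - _]opprB mulNr; under eq_bigr do rewrite cexpMn.
rewrite -subrX1 cabsN -cexpMn (le_trans (cabsB _ _ _))//.
by rewrite cabs_cexp cabs1.
Qed.

Lemma cabs_1subX (z : R[i]) n : cabs z = 1 -> cabs (1 - z ^+ n) <= n%:R * cabs (1 - z).
Proof.
move=> z1; have zn j : cabs (z ^+ j) = 1.
  by elim: j => [|j IH]; rewrite ?expr0 ?cabs1// exprS cabsM z1 IH mulr1.
rewrite -cabsN opprB subrX1 cabsM mulrC -[cabs (z - 1)]cabsN opprB.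
apply: ler_wpM2r; first exact: cabs_ge0.
rewrite (le_trans (cabs_sum _ _ _ _ _))//.
by under eq_bigr do rewrite zn; rewrite sumr_const card_ord.
Qed.

(** Each term satisfies $|1 - e(jx)| \le j\,|1 - e(x)| \le j/m$, and the average of $j/m$ over $j <
    m$ is at most 1/2. *)
Lemma cabs_dirichlet_ge_half m x : (0 < m)%N -> cabs (1 - cexp x) <= m%:R^-1 ->
  2^-1 <= cabs (dirichlet m x).
Proof.
move=> m0 h; have mR : 0 < m%:R :> R by rewrite ltr0n.
have d1 : cabs (1 - dirichlet m x) <= 2^-1.
  rewrite (_ : 1 - _ = m%:R^-1 * \sum_(j < m) (1 - cexp (j%:R * x))); last first.
    rewrite /dirichlet sumrB mulrBr sumr_const card_ord mulVf//.
    by rewrite pnatr_eq0 -lt0n.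
  rewrite cabsM cabsV cabs_nat ler_pdivrMl// (le_trans (cabs_sum _ _ _ _ _))//.
  have : \sum_(j < m) cabs (1 - cexp (j%:R * x)) <= \sum_(j < m) j%:R * m%:R^-1.
    apply: ler_sum => j _; rewrite cexpMn.
    by rewrite (le_trans (cabs_1subX _ _ (cabs_cexp _)))// ler_wpM2l.
  move=> /le_trans -> //; rewrite -mulr_suml ler_pdivrMr//.
  have gauss n : \sum_(j < n) j%:R <= n%:R ^+ 2 / 2 :> R.
    elim: n => [|n IH]; first by rewrite big_ord0 expr0n mul0r.
    rewrite big_ord_recr /= -natr1; move: IH; set S := \sum_(_ < _) _.
    by set y := n%:R; lra.
  by apply: le_trans (gauss m) _; rewrite expr2 mulrAC.
have := cabsD _ (1 - dirichlet m x) (dirichlet m x).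
by rewrite subrK cabs1; lra.
Qed.

(** Expanding the square gives characters of frequency $(j-l)v$. The size of [M] prevents aliasing,
    so only the [m] diagonal terms out of $m^2$ survive the summation over the grid. *)
Lemma dirichlet_mean_square (d M m : nat) (v : Zd d) : (0 < m)%N -> v != 0 ->
  (forall i, (m * `|v i| < M)%N) ->
  \sum_(z : grid d M) cabs (dirichlet m (phase d M v z)) ^+ 2 = (M ^ d)%:R / m%:R.
Proof.
move=> m0 v0 vM; have mR : m%:R != 0 :> R[i] by rewrite pnatr_eq0 -lt0n.
apply: (@complexI R); rewrite rmorph_sum /= fmorph_div /= !rmorph_nat.
have E z : ((cabs (dirichlet m (phase d M v z)) ^+ 2)%:C)%C =
    m%:R^-1 ^+ 2 * \sum_(j < m) \sum_(l < m)
      cexp (phase d M [ffun i => (j%:Z - l%:Z) * v i] z).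
  rewrite cabs_sqr /dirichlet rmorphM /= conjc_inv conjc_nat mulrACA -expr2.
  congr (_ * _); rewrite rmorph_sum /= mulr_suml; apply: eq_bigr => j _.
  rewrite mulr_sumr; apply: eq_bigr => l _.
  rewrite -[X in _ * X]/((cexp (l%:R * phase d M v z))^*%C).
  by rewrite phaseZ -cexpN -cexpD intrB -!pmulrn mulrBl.
under eq_bigr do rewrite E.
rewrite -mulr_sumr exchange_big /=.
rewrite (_ : \sum_(j < m) _ = m%:R * (M ^ d)%:R); first by field.
transitivity (\sum_(j < m) ((M ^ d)%:R : R[i])); last first.
  by rewrite sumr_const card_ord mulr_natl.
apply: eq_bigr => j _; rewrite exchange_big /= (bigD1 j)//= [X in _ + X]big1 ?addr0.
  rewrite (eq_bigr (fun=> 1)) ?sumr_const ?card_ffun ?card_ord//.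
  by move=> z _; rewrite phaseZ subrr mul0r cexp0.
move=> l lj; apply: grid_orthogonality.
- apply: contraNneq v0 => h; apply/eqP/ffunP => i.
  have := congr1 (fun f : Zd d => f i) h; rewrite !ffunE => /eqP.
  rewrite mulf_eq0 subr_eq0 => /orP[/eqP [] jl|/eqP//].
  by move: lj; rewrite -val_eqE /= jl eqxx.
- move=> i; rewrite ffunE abszM; apply: leq_ltn_trans (vM i).
  rewrite leq_mul2r; apply/orP; right.
  have := ltn_ord j; have := ltn_ord l; lia.
Qed.

End Exponentials.

(** * Separated phases, and Fourier series with vanishing samples *)

Section NullSpace.
Variable R : realType.

(** If every [z] had a pair closer than [1 / p], the sum of $|D_p|^2$ over all pairs would be at
    least 1/4 everywhere, whereas its grid mean is at most $|s|^2/p < 1/4$. *)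
Lemma separated_grid (d p : nat) (s : seq (Zd d)) : uniq s ->
  (4 * size s ^ 2 < p)%N ->
  exists (M : nat) (z : grid d M), forall k l, k \in s -> l \in s -> k != l ->
    p%:R^-1 < cabs (1 - cexp R (phase R d M k z - phase R d M l z)).
Proof.
move=> us sp; have p0 : (0 < p)%N by exact: leq_ltn_trans sp.
pose dif (k l : Zd d) : Zd d := k - l.
(* The grid size [B.+1] exceeds [p] times every coordinate of every frequency difference, as
   [dirichlet_mean_square] requires. *)
pose B := (\sum_(k <- s) \sum_(l <- s) \sum_i p * `|dif k l i|)%N.
have leB k l i : k \in s -> l \in s -> (p * `|dif k l i| <= B)%N.
  move=> ks ls; rewrite /B (big_rem k)//= (big_rem l)//= (bigD1 i)//= -!addnA.
  exact: leq_addr.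
exists B.+1; apply: contrapT => /forallNP h.
pose D (z : grid d B.+1) k l :=
  cabs (dirichlet R p (phase R d B.+1 k z - phase R d B.+1 l z)) ^+ 2.
have Dge z : 4^-1 <= \sum_(k <- s) \sum_(l <- s | l != k) D z k l.
  have [k [l [ks ls kl hkl]]] : exists k l, [/\ k \in s, l \in s, k != l &
      cabs (1 - cexp R (phase R d B.+1 k z - phase R d B.+1 l z)) <= p%:R^-1].
    apply: contrapT => /forallNP hn; apply: (h z) => k l ks ls kl.
    by rewrite ltNge; apply/negP => hle; apply: (hn k); exists l.
  rewrite (big_rem k)//= (big_rem l)//= eq_sym kl -addrA.
  have -> : 4^-1 = 2^-1 ^+ 2 :> R by rewrite exprVn -natrX.
  have hh := cabs_dirichlet_ge_half R p _ p0 hkl.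
  apply: ler_wpDr; last by rewrite ler_sqr ?nnegrE ?cabs_ge0.
  apply: addr_ge0; first by apply: sumr_ge0 => *; exact: sqr_ge0.
  by apply: sumr_ge0 => *; apply: sumr_ge0 => *; exact: sqr_ge0.
have G0 : 0 < (B.+1 ^ d)%:R :> R by rewrite ltr0n expn_gt0.
have : (B.+1 ^ d)%:R * 4^-1 <=
    \sum_(z : grid d B.+1) \sum_(k <- s) \sum_(l <- s | l != k) D z k l.
  rewrite (_ : _ * _ = \sum_(z : grid d B.+1) 4^-1); first exact: ler_sum.
  by rewrite sumr_const card_ffun !card_ord mulr_natl.
rewrite exchange_big /=; under eq_bigr do rewrite exchange_big /=.
apply/negP; rewrite -ltNge.
apply: (@le_lt_trans _ _ (\sum_(k <- s) \sum_(l <- s) (B.+1 ^ d)%:R / p%:R)).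
  rewrite big_seq [leRHS]big_seq; apply: ler_sum => k ks.
  rewrite big_mkcond big_seq [leRHS]big_seq; apply: ler_sum => l ls.
  case: ifP => [lk|_]; last by rewrite divr_ge0.
  rewrite -(dirichlet_mean_square R d B.+1 p (k - l))//.
  - by under [leRHS]eq_bigr do rewrite phaseB.
  - by rewrite subr_eq0 eq_sym.
  - by move=> i; rewrite ltnS; exact: leB.
rewrite !big_const_seq !count_predT !iter_addr_0 -mulrnA -[_ *+ (_ * _)]mulr_natr -mulrA.
rewrite ltr_pM2l// ltr_pdivrMl ?ltr0n// ltr_pdivlMr//.
by rewrite -natrM ltr_nat mulnC.
Qed.

Variables (T : choiceType) (s : seq T) (th : T -> R) (p m : nat).
Hypotheses (us : uniq s) (p0 : (0 < p)%N) (s0 : (0 < size s)%N)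
  (mE : m = (4 * size s * p)%N).
Hypothesis sep : forall k l, k \in s -> l \in s -> k != l ->
  p%:R^-1 < cabs (1 - cexp R (th k - th l)).

Let D x := cabs (dirichlet R m x).

Let m0 : (0 < m)%N. Proof. by rewrite mE !muln_gt0 s0 p0. Qed.

(** In this form separation is a distance between points of the unit circle, to which the triangle
    inequality applies. *)
Lemma cabs_cexpB x y : cabs (1 - cexp R (x - y)) = cabs (cexp R y - cexp R x).
Proof.
have -> : cexp R y - cexp R x = cexp R y * (1 - cexp R (x - y)).
  by rewrite mulrBr mulr1 -cexpD addrCA subrr addr0.
by rewrite cabsM cabs_cexp mul1r.
Qed.

Let D_far x (q : R) : 0 < q -> q <= cabs (1 - cexp R x) -> D x <= 2 / (m%:R * q).
Proof.
move=> q0 qx; have := cabs_dirichlet_decay R m x m0; rewrite -/(D x) => h.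
rewrite ler_pdivlMr; last by rewrite mulr_gt0// ltr0n.
rewrite [m%:R * q]mulrC mulrA -ler_pdivlMr ?ltr0n//.
by apply: le_trans h; rewrite ler_wpM2l// cabs_ge0.
Qed.

Let pR : 0 < p%:R :> R. Proof. by rewrite ltr0n. Qed.
Let sR : 0 < (size s)%:R :> R. Proof. by rewrite ltr0n. Qed.

(** By separation each term is at most $2p/m = 1/(2|s|)$, which is what fixes the choice of [m]. *)
Let sum_D_near k : k \in s -> \sum_(l <- s | l != k) D (th k - th l) <= 2^-1.
Proof.
move=> ks; apply: (@le_trans _ _ (\sum_(l <- s) (2 / (m%:R * p%:R^-1)))).
  rewrite big_mkcond big_seq [leRHS]big_seq; apply: ler_sum => l ls.
  case: ifP => [lk|_]; last by rewrite divr_ge0// mulr_ge0.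
  apply: D_far; first by rewrite invr_gt0.
  by apply/ltW/sep; rewrite // eq_sym.
rewrite big_const_seq count_predT iter_addr_0 -[_ *+ size s]mulr_natr mE !natrM.
rewrite le_eqVlt; apply/orP; left; apply/eqP.
by field; rewrite !gt_eqF.
Qed.

(** At most one point of [s] lies within [1 / (2p)] of [y] on the circle; it contributes at most 1.
    Every other term is at most $4p/m = 1/|s|$. *)
Let sum_D_all y : \sum_(l <- s) D (y - th l) <= 2.
Proof.
have far l : l \in s -> (2 * p%:R)^-1 <= cabs (1 - cexp R (y - th l)) ->
    D (y - th l) <= (size s)%:R^-1.
  move=> ls h; apply: le_trans (D_far _ _ _ h) _.
    by rewrite invr_gt0 mulr_gt0.
  rewrite mE !natrM le_eqVlt; apply/orP; left; apply/eqP.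
  by field; rewrite !gt_eqF.
have tot : \sum_(l <- s) (size s)%:R^-1 = 1 :> R.
  rewrite big_const_seq count_predT iter_addr_0 -[_ *+ size s]mulr_natr mulVf//.
  by rewrite gt_eqF.
have [[k ks hk]|none] :=
    pselect (exists2 k, k \in s & cabs (1 - cexp R (y - th k)) < (2 * p%:R)^-1).
  rewrite (big_rem k)//= -[leRHS]/(1 + 1); apply: lerD.
    exact: cabs_dirichlet_le1.
  rewrite -tot [leRHS](big_rem k)//= ler_wpDl ?invr_ge0//.
  rewrite big_seq [leRHS]big_seq; apply: ler_sum => l.
  rewrite mem_rem_uniq// inE => /andP[lk ls]; apply: far => //.
  have := sep k l ks ls; rewrite eq_sym => /(_ lk); rewrite !cabs_cexpB in hk *.
  have := cabsD R (cexp R (th l) - cexp R y) (cexp R y - cexp R (th k)).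
  rewrite addrA subrK invfM -[cabs (cexp R y - _)]cabsN opprB => h1 h2.
  by rewrite invfM in hk; lra.
apply: (@le_trans _ _ 1); last by rewrite ler1n.
rewrite -tot big_seq [leRHS]big_seq; apply: ler_sum => l ls; apply: far => //.
by rewrite leNgt; apply/negP => hl; apply: none; exists l.
Qed.

(* Pairing the vanishing samples with [cexp (- j * th l)] turns them into
   convolution with the Dirichlet kernel, which on [s] is a perturbation of
   the identity of l1-norm at most 1/2. *)
Lemma head_le_tail (c : T -> R[i]) : csumm R T c ->
  (forall j, (j < m)%N -> csum (fun k => c k * cexp R (j%:R * th k)) = 0) ->
  \sum_(k <- s) cabs (c k) <= 8 * tsum R T (fun k => if k \in s then 0 else cabs (c k)).
Proof.
move=> sc van.
pose r k := if k \in s then 0 else c k.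
have rE : (fun k => if k \in s then 0 else cabs (c k)) = (fun k => cabs (r k)).
  by apply/funext => k; rewrite /r; case: ifP; rewrite ?cabs0.
rewrite rE; have sr : csumm R T r.
  by apply: csumm_le sc _ => k; rewrite /r; case: ifP; rewrite ?cabs0 ?cabs_ge0.
pose K l k := dirichlet R m (th k - th l).
have sK (v : T -> R[i]) l : csumm R T v -> csumm R T (fun k => v k * K l k).
  move=> sv; apply: csumm_le sv _ => k; rewrite cabsM ler_piMr ?cabs_ge0//.
  exact: cabs_dirichlet_le1.
have G0 l : csum (fun k => c k * K l k) = 0.
  have sF (j : 'I_m) : csumm R T (fun k => c k * cexp R (j%:R * th k)).
    by apply: csumm_le sc _ => k; rewrite cabsM cabs_cexp mulr1.
  have [_] := csum_sum R T _ (index_enum 'I_m)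
    (fun j k => c k * cexp R (j%:R * th k))
    (fun j => m%:R^-1 * cexp R (- (j%:R * th l))) sF.
  rewrite [RHS]big1; last by move=> j _; rewrite van ?mulr0.
  move=> <-; congr csum; apply/funext => k.
  rewrite /K /dirichlet !mulr_sumr; apply: eq_bigr => j _.
  by rewrite mulrBr cexpD; ring.
have G1 l : \sum_(k <- s) c k * K l k = - csum (fun k => r k * K l k).
  pose g k := if k \in s then c k else 0.
  have sg : csumm R T g.
    by apply: csumm_le sc _ => k; rewrite /g; case: ifP; rewrite ?cabs0 ?cabs_ge0.
  have := G0 l; have -> : (fun k => c k * K l k) =
      (fun k => 1 * (g k * K l k) + r k * K l k).
    by apply/funext => k; rewrite /g /r; case: ifP; rewrite mul0r mul1r ?addr0 ?add0r.
  rewrite csum_lin ?mul1r; [|exact: sK|exact: sK].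
  rewrite (csum_seq _ _ _ s)//; last by move=> k /negbTE ks; rewrite /g ks mul0r.
  move=> /eqP; rewrite addr_eq0 => /eqP <-.
  by rewrite big_seq [RHS]big_seq; apply: eq_bigr => k ks; rewrite /g ks.
set A := \sum_(k <- s) cabs (c k); set B := tsum _ _ _.
(* The 4 is the 2 of [cabs_csum] times the 2 of [sum_D_all]. *)
have up : \sum_(l <- s) cabs (\sum_(k <- s) c k * K l k) <= 4 * B.
  apply: (@le_trans _ _ (\sum_(l <- s) 2 * tsum R T (fun k => cabs (r k * K l k)))).
    by apply: ler_sum => l _; rewrite G1 cabsN; apply: cabs_csum; exact: sK.
  rewrite -mulr_sumr -tsum_sum; last 2 first.
  - by move=> l k; exact: cabs_ge0.
  - by move=> l _; exact: sK.
  have -> : 4 = 2 * 2 :> R by rewrite -natrM.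
  rewrite -mulrA ler_wpM2l// -tsumZ//; last first.
    by move=> k; exact: cabs_ge0.
  apply: le_tsum.
  - by move=> k; apply: sumr_ge0 => *; exact: cabs_ge0.
  - exact: summZ.
  - move=> k; under eq_bigr do rewrite cabsM.
    by rewrite -mulr_sumr mulrC ler_wpM2r ?cabs_ge0//; exact: sum_D_all.
(* The diagonal entries of the kernel matrix equal 1, and each column has off-diagonal sum at most
   1/2 by [sum_D_near], so at least half of the l1-norm is retained. *)
have low : A / 2 <= \sum_(l <- s) cabs (\sum_(k <- s) c k * K l k).
  have lowl l : l \in s -> cabs (c l) - \sum_(k <- s | k != l) cabs (c k) * D (th k - th l)
      <= cabs (\sum_(k <- s) c k * K l k).
    move=> ls; rewrite lerBlDr.
    have -> : c l = \sum_(k <- s) c k * K l k - \sum_(k <- s | k != l) c k * K l k.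
      rewrite (bigD1_seq l ls us)/= addrK.
      rewrite /K subrr /dirichlet.
      rewrite (eq_bigr (fun=> 1)); last by move=> j _; rewrite mulr0 cexp0.
      by rewrite sumr_const card_ord mulVf ?mulr1// pnatr_eq0 -lt0n.
    apply: le_trans (cabsB _ _ _) _; rewrite lerD2l.
    apply: le_trans (cabs_sum _ _ _ _ _) _.
    by apply: ler_sum => k _; rewrite cabsM.
  apply: (@le_trans _ _ (\sum_(l <- s)
     (cabs (c l) - \sum_(k <- s | k != l) cabs (c k) * D (th k - th l)))); last first.
    by rewrite big_seq [leRHS]big_seq; apply: ler_sum.
  rewrite sumrB -/A (exchange_big_dep xpredT)//=.
  suff : \sum_(k <- s) \sum_(l <- s | k != l) cabs (c k) * D (th k - th l) <= A / 2.
    by set X := \sum_(_ <- _) _; lra.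
  rewrite /A mulr_suml big_seq [leRHS]big_seq; apply: ler_sum => k ks.
  rewrite -mulr_sumr ler_wpM2l ?cabs_ge0//.
  by under eq_bigl do rewrite eq_sym; exact: sum_D_near.
by have := le_trans low up; lra.
Qed.

(** The part on [s] is a finite sum and costs the 8 of [head_le_tail]; the part outside [s] costs
    the 2 of [cabs_csum]. *)
Lemma cabs_csum_le_tail (c : T -> R[i]) (u : T -> R[i]) : csumm R T c ->
  (forall j, (j < m)%N -> csum (fun k => c k * cexp R (j%:R * th k)) = 0) ->
  (forall k, cabs (u k) <= 1) ->
  cabs (csum (fun k => c k * u k)) <=
    10 * tsum R T (fun k => if k \in s then 0 else cabs (c k)).
Proof.
move=> sc van u1; have := head_le_tail c sc van.
pose r k := if k \in s then 0 else c k; pose g k := if k \in s then c k else 0.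
have rE : (fun k => if k \in s then 0 else cabs (c k)) = (fun k => cabs (r k)).
  by apply/funext => k; rewrite /r; case: ifP; rewrite ?cabs0.
rewrite rE => AB; have sr : csumm R T r.
  by apply: csumm_le sc _ => k; rewrite /r; case: ifP; rewrite ?cabs0 ?cabs_ge0.
have sg : csumm R T g.
  by apply: csumm_le sc _ => k; rewrite /g; case: ifP; rewrite ?cabs0 ?cabs_ge0.
have su v : csumm R T v -> csumm R T (fun k => v k * u k).
  by move=> sv; apply: csumm_le sv _ => k; rewrite cabsM ler_piMr ?cabs_ge0.
have -> : (fun k => c k * u k) = (fun k => 1 * (g k * u k) + r k * u k).
  by apply/funext => k; rewrite /g /r; case: ifP; rewrite mul0r mul1r ?addr0 ?add0r.
rewrite csum_lin ?mul1r; [|exact: su|exact: su].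
apply: le_trans (cabsD _ _ _) _.
have h1 : cabs (csum (fun k => g k * u k)) <= \sum_(k <- s) cabs (c k).
  rewrite (csum_seq _ _ _ s)//; last by move=> k /negbTE ks; rewrite /g ks mul0r.
  apply: le_trans (cabs_sum _ _ _ _ _) _; rewrite big_seq [leRHS]big_seq.
  by apply: ler_sum => k ks; rewrite cabsM /g ks ler_piMr ?cabs_ge0.
have h2 : cabs (csum (fun k => r k * u k)) <= 2 * tsum R T (fun k => cabs (r k)).
  apply: le_trans (cabs_csum _ _ _ (su _ sr)) _; rewrite ler_wpM2l//.
  apply: le_tsum => // k; first exact: cabs_ge0.
  by rewrite cabsM ler_piMr ?cabs_ge0.
by move: AB h1 h2; set B := tsum _ _ _; lra.
Qed.

End NullSpace.

(** * Largest terms of a summable family, and the Cauchy-Schwarz inequality *)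

Section BestTerms.
Variables (R : realType) (T : choiceType).

(** Maximal terms are picked one after another. Without a maximum outside [s] there would be
    arbitrarily long increasing chains of terms, all at least a fixed positive [q k0], contradicting
    summability. *)
Lemma largest_terms (q : T -> R) : (forall s : seq T, exists k, k \notin s) ->
  (forall k, 0 < q k) -> summ R T q ->
  forall n, exists s : seq T, [/\ uniq s, size s = n &
    forall k l, k \in s -> l \notin s -> q l <= q k].
Proof.
move=> inf q0 sq; have q0' k : 0 <= q k by exact: ltW.
elim=> [|n [s [us ss hs]]]; first by exists [::].
suff [k ks hk] : exists2 k, k \notin s & forall l, l \notin s -> q l <= q k.
  exists (k :: s); rewrite /= ks us ss; split => // k' l.
  rewrite !inE negb_or => /orP[/eqP ->|k's] /andP[_ ls]; [exact: hk|exact: hs].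
apply: contrapT => nomax.
have step k : k \notin s -> exists2 l, l \notin s & q k < q l.
  move=> ks; apply: contrapT => h; apply: nomax; exists k => // l ls.
  by rewrite leNgt; apply/negP => kl; apply: h; exists l.
have [k0 k0s] := inf s.
have chain N : exists k t, [/\ uniq (k :: t), size t = N, k \notin s &
    forall x, x \in k :: t -> q k0 <= q x <= q k].
  elim: N => [|N [k [t [ut st ks ht]]]].
    exists k0, [::]; split => // x; rewrite inE => /eqP ->.
    by rewrite lexx.
  have [l ls kl] := step k ks; exists l, (k :: t); split => //.
  - rewrite cons_uniq ut andbT; apply/negP => /ht /andP[_].
    by rewrite leNgt kl.
  - by rewrite /= st.
  - move=> x; rewrite inE => /orP[/eqP ->|/ht /andP[h1 h2]].
      have /andP[h _] := ht k (mem_head _ _).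
      by rewrite lexx andbT (le_trans h)// ltW.
    by rewrite h1 (le_trans h2)// ltW.
have [N hN] : exists N : nat, tsum R T q < N%:R * q k0.
  exists (Num.truncn (tsum R T q / q k0)).+1.
  by rewrite -ltr_pdivrMr// truncnS_gt.
have [k [t [ut st _ ht]]] := chain N.
have := le_tsum_seq R T q (k :: t) q0' sq ut.
suff : N%:R * q k0 <= \sum_(x <- k :: t) q x by move=> h /(le_trans h); rewrite leNgt hN.
apply: (@le_trans _ _ (\sum_(x <- k :: t) q k0)).
  rewrite big_const_seq count_predT iter_addr_0 /= st -[_ *+ N.+1]mulr_natl.
  by rewrite ler_wpM2r// ler_nat.
by rewrite big_seq [leRHS]big_seq; apply: ler_sum => x /ht /andP[].
Qed.

(** The right-hand side of Young's inequality is smallest at $t = \sqrt{B/A}$, where it equals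
    $2\sqrt{AB}$; vanishing [A] or [B] needs another [t]. *)
Lemma le_sqrt_of_young (A B X : R) : 0 <= A -> 0 <= B ->
  (forall t, 0 < t -> 2 * X <= t * A + t^-1 * B) -> X <= Num.sqrt A * Num.sqrt B.
Proof.
move=> A0 B0 h; have S0 : 0 <= Num.sqrt A * Num.sqrt B by rewrite mulr_ge0 ?sqrtr_ge0.
have [X0|X0] := leP X 0; first exact: le_trans X0 S0.
have [Az|An] := eqVneq A 0.
  (* With [A = 0] this choice gives $2X \le XB/(B+1)$, impossible for positive [X]; the case [B = 0]
     is symmetric. *)
  have := h ((B + 1) / X); rewrite divr_gt0 ?ltr_wpDl// => /(_ isT).
  rewrite Az mulr0 add0r invf_div mulrAC ler_pdivlMr; last by rewrite ltr_wpDl.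
  by move: X0 B0; nra.
have [Bz|Bn] := eqVneq B 0.
  have := h (X / (A + 1)); rewrite divr_gt0 ?ltr_wpDl// => /(_ isT).
  rewrite Bz mulr0 addr0 mulrAC ler_pdivlMr; last by rewrite ltr_wpDl.
  by move: X0 A0; nra.
have a0 : 0 < Num.sqrt A by rewrite sqrtr_gt0 lt_neqAle eq_sym An.
have b0 : 0 < Num.sqrt B by rewrite sqrtr_gt0 lt_neqAle eq_sym Bn.
move: {S0} (Num.sqrt A) (sqr_sqrtr A0) a0 => a Aa a0.
move: (Num.sqrt B) (sqr_sqrtr B0) b0 => b Bb b0.
have := h (b / a); rewrite divr_gt0// => /(_ isT).
rewrite (_ : _ + _ = 2 * (a * b)); first by rewrite ler_pM2l.
by rewrite -Aa -Bb; field; rewrite !gt_eqF.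
Qed.

(** Young's inequality is summed termwise for each [t] and then optimised; [t = 1] already yields
    summability. *)
Lemma tsum_cauchy_schwarz (a b x : T -> R) : (forall k, 0 <= a k) ->
  (forall k, 0 <= b k) -> (forall k, 0 <= x k) -> (forall k, x k ^+ 2 <= a k * b k) ->
  summ R T a -> summ R T b ->
  summ R T x /\ tsum R T x <= Num.sqrt (tsum R T a) * Num.sqrt (tsum R T b).
Proof.
move=> a0 b0 x0 xab sa sb.
have young t k : 0 < t -> 2 * x k <= t * a k + t^-1 * b k.
  move=> t0; rewrite -ler_sqr ?nnegrE ?addr_ge0 ?mulr_ge0 ?invr_ge0 ?(ltW t0)//.
  apply: (@le_trans _ _ (4 * (a k * b k))).
    by rewrite exprMn -natrX ler_wpM2l.
  rewrite -subr_ge0 (_ : _ - _ = (t * a k - t^-1 * b k) ^+ 2) ?sqr_ge0//.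
  by field; rewrite gt_eqF.
have sx : summ R T x.
  apply: (summ_le _ _ _ _ (summD _ _ _ _ sa sb)) => k.
  rewrite !ger0_norm ?addr_ge0//; have := young 1 k ltr01.
  by rewrite invr1 !mul1r; have := x0 k; lra.
split=> //; apply: le_sqrt_of_young; rewrite ?tsum_ge0// => t t0.
have t0' := ltW t0; have ti0 : 0 <= t^-1 by rewrite invr_ge0.
rewrite -!tsumZ// -tsumD.
- apply: le_tsum => [k||k]; [by rewrite mulr_ge0| |exact: young].
  by apply: summD; exact: summZ.
- by move=> k; rewrite mulr_ge0.
- by move=> k; rewrite mulr_ge0.
- exact: summZ.
- exact: summZ.
Qed.

End BestTerms.

(** * Weighted Fourier spaces and the error of sampling algorithms *)

Section WeightedSpace.
Variables (R : realType) (d : nat) (w : Zd d -> R).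
Hypotheses (w_pos : forall k, 0 < w k)
  (w_sum : (\esum_(k in [set: Zd d]) ((w k) ^-2)%:E < +oo)%E).

Definition tailrad (s : seq (Zd d)) : R :=
  Num.sqrt (tsum R (Zd d) (fun k => if k \in s then 0 else (w k) ^- 2)).

Let q0 k : 0 <= w k ^- 2.
Proof. by rewrite invr_ge0 sqr_ge0. Qed.

Lemma summ_winv2 : summ R (Zd d) (fun k => w k ^- 2).
Proof. by apply/summ_ge0. Qed.

Lemma summ_tail (s : seq (Zd d)) : summ R (Zd d) (fun k => if k \in s then 0 else (w k) ^- 2).
Proof.
by apply: summ_le summ_winv2 _ => k; case: ifP; rewrite ?normr0.
Qed.

Lemma tailrad_ge0 (s : seq (Zd d)) : 0 <= tailrad s.
Proof. exact: sqrtr_ge0. Qed.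

(** Cauchy-Schwarz for the factorisation $|c_k| = (|c_k| w_k) \cdot w_k^{-1}$; this is what makes
    every Fourier series in the space absolutely convergent. *)
Lemma tail_cauchy_schwarz (c : Seq R d) (s : seq (Zd d)) : inH w c ->
  csumm R (Zd d) c /\ tsum R (Zd d) (fun k => if k \in s then 0 else cabs (c k)) <=
  Num.sqrt (fine (Hnorm2 w c)) * tailrad s.
Proof.
move=> hc; pose a k := cabs (c k) ^+ 2 * w k ^+ 2.
have a0 k : 0 <= a k by rewrite mulr_ge0 ?sqr_ge0.
have sa : summ R (Zd d) a by apply/summ_ge0.
have wk k : w k != 0 by rewrite gt_eqF.
have c0 k : 0 <= cabs (c k) by exact: cabs_ge0.
have cq k : cabs (c k) ^+ 2 <= a k * w k ^- 2 by rewrite /a mulfK// expf_neq0.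
have [h1 _] := tsum_cauchy_schwarz R (Zd d) a (fun k => w k ^- 2)
  (fun k => cabs (c k)) a0 q0 c0 cq sa summ_winv2.
split=> //; apply: (tsum_cauchy_schwarz _ _ a _ _ _ _ _ _ sa (summ_tail s)).2 => //.
- by move=> k; case: ifP.
- by move=> k; case: ifP.
- by move=> k; case: ifP => _; rewrite ?expr0n ?mulr0.
Qed.

Lemma unit_ball_inH (c : Seq R d) : unit_ball w c -> inH w c.
Proof. by move=> /le_lt_trans; apply; exact: ltry. Qed.

Lemma Hnorm2_ge0 (c : Seq R d) : (0 <= Hnorm2 w c)%E.
Proof. by apply: esum_ge0 => k _; rewrite lee_fin mulr_ge0 ?sqr_ge0. Qed.

Lemma unit_ball_norm (c : Seq R d) : unit_ball w c ->
  Num.sqrt (fine (Hnorm2 w c)) <= 1.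
Proof.
move=> hc; rewrite -[leRHS]sqrtr1 ler_sqrt// -lee_fin fineK//.
by rewrite ge0_fin_numE ?Hnorm2_ge0//; exact: unit_ball_inH.
Qed.

Lemma csumm_ebasis (c : Seq R d) x : csumm R (Zd d) c ->
  csumm R (Zd d) (fun k => c k * ebasis k x).
Proof.
by move=> sc; apply: csumm_le sc _ => k; rewrite cabsM (cabs_cexp R (dotp k x)) mulr1.
Qed.

Lemma fval_lin (a : R[i]) (c1 c2 : Seq R d) x : csumm R (Zd d) c1 ->
  csumm R (Zd d) c2 ->
  fval (fun k => a * c1 k + c2 k) x = a * fval c1 x + fval c2 x.
Proof.
move=> s1 s2; rewrite /fval -csum_lin; last 2 first.
- exact: csumm_ebasis.
- exact: csumm_ebasis.
by congr csum; apply/funext => k; rewrite mulrDl mulrA.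
Qed.

(** Absolute convergence makes point evaluation linear and bounded; with the empty list the tail is
    the whole family. *)
Lemma Lam_std_subset : @Lam_std R d `<=` Lam_all w.
Proof.
move=> _ [x [_ ->]]; split.
  move=> a c1 c2 h1 h2; apply: fval_lin.
  - exact: (tail_cauchy_schwarz _ [::] h1).1.
  - exact: (tail_cauchy_schwarz _ [::] h2).1.
exists (2 * tailrad [::]) => c hc; have [sc hcs] := tail_cauchy_schwarz c [::] hc.
apply: le_trans (cabs_csum _ _ _ (csumm_ebasis _ _ sc)) _.
rewrite -mulrA ler_wpM2l// mulrC; apply: le_trans hcs.
rewrite le_eqVlt; apply/orP; left; apply/eqP; congr tsum; apply/funext => k.
by rewrite in_nil cabsM (cabs_cexp R (dotp k x)) mulr1.
Qed.

(** The difference of two elements of the unit ball with equal samples has vanishing samples and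
    tail l1-norm at most twice [tailrad s], so [cabs_csum_le_tail] gives 10 times 2. *)
Lemma std_error_le (s : seq (Zd d)) : uniq s -> (0 < size s)%N ->
  (nth_err (20 * size s ^ 3) w (@Lam_std R d) <= (20 * tailrad s)%:E)%E.
Proof.
(* [p] is just above the threshold of [separated_grid], and [n] is then $4|s|p$. *)
move=> us s0; set n := (20 * _)%N; pose p := (5 * size s ^ 2)%N.
have p4 : (4 * size s ^ 2 < p)%N by rewrite /p ltn_mul2r expn_gt0 s0.
have p0 : (0 < p)%N by exact: leq_ltn_trans p4.
have nE : n = (4 * size s * p)%N by rewrite /n /p; lia.
have [M [z sep]] := separated_grid R d p s us p4.
rewrite /nth_err ifF; last by apply/negbTE; rewrite -lt0n /n !(muln_gt0, expn_gt0) s0.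
pose L (i : 'I_n) (c : Seq R d) := fval c (gridpt R d M z i).
(* The algorithm returns any unit-ball interpolant of the data; the default 0 serves only data that
   no element of the ball produces. *)
pose phi y := fval (xget (fun=> 0) [set c | unit_ball w c /\ (fun i => L i c) = y]).
apply: (@le_trans _ _ (wc_err w L phi)).
  apply: ereal_inf_lbound; exists L, phi; split => // i.
  by exists (gridpt R d M z i); split => //; exact: gridpt_cube.
apply: ge_ereal_sup => _ [c hc <-]; apply: ge_ereal_sup => _ [x _ <-].
rewrite lee_fin /phi; set c' := xget _ _.
have [hc' Lc'] : [set c'' | unit_ball w c'' /\ (fun i => L i c'') = fun i => L i c] c'.
  by apply: xgetPex; exists c.
have tl := tail_cauchy_schwarz _ s (unit_ball_inH _ _).
have [[sc tc] [sc' tc']] := (tl c hc, tl c' hc').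
have leT (e : Seq R d) : unit_ball w e ->
    Num.sqrt (fine (Hnorm2 w e)) * tailrad s <= tailrad s.
  by move=> he; rewrite ler_piMl ?tailrad_ge0// unit_ball_norm.
pose e k := - 1 * c' k + c k.
have se : csumm R (Zd d) e by exact: csumm_lin.
have fe y : fval e y = fval c y - fval c' y by rewrite fval_lin// mulN1r addrC.
rewrite -fe.
have van j : (j < n)%N ->
    csum (fun k => e k * cexp R (j%:R * phase R d M k z)) = 0.
  move=> jn; rewrite -[RHS](subrr (fval c (gridpt R d M z j))).
  have := congr1 (fun f => f (Ordinal jn)) Lc'; rewrite /L /= => {2}<-.
  rewrite -fe; congr csum; apply/funext => k.
  by rewrite ebasis_gridpt.
apply: le_trans (cabs_csum_le_tail R _ s _ p n us p0 s0 nE sep e (fun k => ebasis k x) se van _) _.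
  by move=> k; rewrite (cabs_cexp R (dotp k x)).
have -> : 20 = 10 * 2 :> R by rewrite -natrM.
rewrite -mulrA ler_wpM2l//.
pose tl' (u : Seq R d) k := if k \in s then 0 else cabs (u k).
have stl u : csumm R (Zd d) u -> summ R (Zd d) (tl' u).
  move=> su; apply: summ_le su _ => k; rewrite /tl'.
  by case: ifP => _; rewrite ?normr0 ?ger0_norm ?cabs_ge0.
have tl0 u k : 0 <= tl' u k by rewrite /tl'; case: ifP => // _; exact: cabs_ge0.
apply: (@le_trans _ _ (tsum R (Zd d) (tl' c) + tsum R (Zd d) (tl' c'))).
  rewrite -tsumD//; [|exact: stl|exact: stl].
  apply: le_tsum => [k||k]; [exact: (tl0 e)|by apply: summD; exact: stl|].
  rewrite /tl'; case: ifP => _; first by rewrite addr0.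
  by rewrite /e mulN1r addrC; exact: cabsB.
rewrite mulr2n mulrDl mul1r; apply: lerD.
- exact: le_trans tc (leT _ hc).
- exact: le_trans tc' (leT _ hc').
Qed.

End WeightedSpace.

(** * Orthogonal projections of complex matrices *)

Section Projections.
Variable R : realType.

Definition adjoint (m n : nat) (A : 'M[R[i]]_(m, n)) : 'M[R[i]]_(n, m) :=
  (map_mx (@conjc R) A)^T.

Lemma adjointE m n (A : 'M_(m, n)) i j : adjoint m n A i j = (A j i)^*%C.
Proof. by rewrite !mxE. Qed.

Lemma adjointM m n p (A : 'M_(m, n)) (B : 'M_(n, p)) :
  adjoint m p (A *m B) = adjoint n p B *m adjoint m n A.
Proof. by rewrite /adjoint map_mxM trmx_mul. Qed.

Lemma adjoint_mul_self n (u : 'cV_n) :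
  (adjoint n 1 u *m u) 0 0 = (\sum_i cabs (u i 0) ^+ 2)%:C%C.
Proof.
rewrite mxE rmorph_sum; apply: eq_bigr => i _.
by rewrite [RHS]cabs_sqr !mxE mulrC.
Qed.

(* An orthogonal projection of corank at most [n] annihilating [n] given
   vectors, obtained by splitting off one rank-one projection per vector. *)
Lemma annihilating_projection N n (l : nat -> 'cV[R[i]]_N) :
  exists P : 'M[R[i]]_N, [/\ adjoint N N P = P, P *m P = P,
    forall i, (i < n)%N -> P *m l i = 0 & N%:R - n%:R <= complex.Re (\tr P)].
Proof.
elim: n => [|n [P [Pa PP Pl Pt]]].
  exists 1%:M; split => //.
  - by rewrite /adjoint map_mx1 trmx1.
  - by rewrite mul1mx.
  - by rewrite mxtrace1 subr0 -(rmorph_nat (@real_complex_def R (Phant R))).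
pose u := P *m l n; have [u0|un0] := eqVneq u 0.
  exists P; split => //.
  - by move=> i; rewrite ltnS leq_eqVlt => /orP[/eqP ->//|]; exact: Pl.
  - by apply: le_trans Pt; rewrite lerD2l lerN2 ler_nat.
pose ua := adjoint N 1 u; pose rho := (ua *m u) 0 0.
have uau : ua *m u = rho%:M by exact: mx11_scalar.
have Pu : P *m u = u by rewrite /u mulmxA PP.
have uaP : ua *m P = ua by rewrite /ua -{2}Pu adjointM Pa.
have rhoE := adjoint_mul_self N u; rewrite -/ua -/rho in rhoE.
have rho0 : rho != 0.
  apply: contraNneq un0 => r0; have /eqP := rhoE; rewrite r0 eq_sym.
  rewrite -(rmorph0 (@real_complex_def R (Phant R))) (inj_eq (@complexI R)).
  rewrite psumr_eq0; last by move=> i _; exact: sqr_ge0.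
  move=> /allP h; apply/eqP/matrixP => i j; rewrite ord1 [RHS]mxE.
  have := h i (mem_index_enum i); rewrite expf_eq0/= => /eqP.
  exact: Normc.eq0_normc.
have rhoJ : (rho^*)%C = rho by rewrite rhoE conjc_real.
have ual : ua *m l n = rho%:M by rewrite -uaP -mulmxA -/u uau.
(* Since [u] lies in the range of [P], removing the orthogonal projection onto [u] leaves a
   projection. It kills [l n], because [P *m l n = u], and its trace drops by exactly 1. *)
exists (P - rho^-1 *: (u *m ua)); split.
- rewrite -{2}Pa; apply/matrixP => i j; rewrite !mxE rmorphB rmorphM /=.
  rewrite conjc_inv rhoJ; congr (_ - _ * _); rewrite rmorph_sum.
  by apply: eq_bigr => k _; rewrite !mxE rmorphM /= conjcK mulrC.
- have Q1 : P *m (u *m ua) = u *m ua by rewrite mulmxA Pu.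
  have Q2 : (u *m ua) *m P = u *m ua by rewrite -mulmxA uaP.
  have Q3 : (u *m ua) *m (u *m ua) = rho *: (u *m ua).
    by rewrite -mulmxA (mulmxA ua) uau mul_scalar_mx -scalemxAr.
  rewrite mulmxBl !mulmxBr PP -!scalemxAl -!scalemxAr Q1 Q2 Q3.
  by rewrite (scalerA rho^-1 rho) mulVf// scale1r subrr subr0.
- move=> i; rewrite ltnS leq_eqVlt mulmxBl -scalemxAl -mulmxA.
  move=> /orP[/eqP ->|ilt].
    by rewrite ual -/u mul_mx_scalar scalerA mulVf// scale1r subrr.
  have uali : ua *m l i = 0 by rewrite -uaP -mulmxA Pl// mulmx0.
  by rewrite uali Pl// mulmx0 scaler0 subr0.
- rewrite raddfB /= mxtraceZ mxtrace_mulC uau mxtrace_scalar mulr1n mulVf//.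
  rewrite raddfB /= -natr1 opprD addrA; lra.
Qed.

(** From $P = P^*P$ one has $P_{ii} = \sum_j |P_{ij}|^2 \ge P_{ii}^2$. *)
Lemma projection_diag N (P : 'M[R[i]]_N) i : adjoint N N P = P -> P *m P = P ->
  P i i = (complex.Re (P i i))%:C%C /\ 0 <= complex.Re (P i i) <= 1.
Proof.
move=> Pa PP; have PE : P i i = (\sum_j cabs (P i j) ^+ 2)%:C%C.
  rewrite -{1}PP mxE rmorph_sum; apply: eq_bigr => j _.
  by rewrite [RHS]cabs_sqr -{2}Pa !mxE.
set S := \sum_j _ in PE; rewrite PE /=; split => //.
have S0 : 0 <= S by apply: sumr_ge0 => j _; exact: sqr_ge0.
rewrite S0 /= leNgt; apply/negP => S1.
have : S ^+ 2 <= S.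
  rewrite {2}/S (bigD1 i)//= PE cabs_real (ger0_norm S0) lerDl.
  by apply: sumr_ge0 => j _; exact: sqr_ge0.
by rewrite expr2 ger_pMr ?leNgt ?S1//; lra.
Qed.

End Projections.

(** * Functionals on trigonometric polynomials, and a rearrangement inequality *)

Section LowerBound.
Variables (R : realType) (d : nat) (w : Zd d -> R).
Hypotheses (w_pos : forall k, 0 < w k)
  (w_sum : (\esum_(k in [set: Zd d]) ((w k) ^-2)%:E < +oo)%E).

(** The coefficient family of the single exponential of frequency [l]. *)
Definition delta_seq (l k : Zd d) : R[i] := (k == l)%:R.

Lemma inH_seq (c : Seq R d) (J : seq (Zd d)) : (forall k, k \notin J -> c k = 0) ->
  inH w c.
Proof.
move=> h; rewrite /inH.
rewrite [Hnorm2 _ _](esumr_seq R _ (fun k => cabs (c k) ^+ 2 * w k ^+ 2) (undup J)).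
- by rewrite ltry.
- exact: undup_uniq.
- by move=> k; rewrite mulr_ge0 ?sqr_ge0.
- by move=> k; rewrite mem_undup => /h ->; rewrite cabs0 expr0n mul0r.
Qed.

Lemma Lam_all_sum (L : Seq R d -> R[i]) (I : eqType) (r : seq I) (a : I -> R[i])
    (kap : I -> Zd d) : Lam_all w L ->
  L (fun k => \sum_(i <- r) a i * delta_seq (kap i) k) =
    \sum_(i <- r) a i * L (delta_seq (kap i)).
Proof.
move=> [Llin _].
have inHs (s : seq I) : inH w (fun k => \sum_(i <- s) a i * delta_seq (kap i) k).
  apply: (@inH_seq _ (map kap s)) => k ks; apply: big1_seq => i /andP[_ is'].
  rewrite /delta_seq; case: eqP => [ki|_]; last by rewrite mulr0.
  by move: ks; rewrite ki map_f.
elim: r => [|i r IH].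
  rewrite big_nil.
  have h0 := inHs [::].
  (* For the empty sum, linearity at [1 * 0 + 0] forces the value of [L] at zero to vanish. *)
  have := Llin 1 _ _ h0 h0; rewrite (_ : (fun k => _ + _) =
      (fun k => \sum_(i <- [::]) a i * delta_seq (kap i) k)).
    by rewrite mul1r => /eqP; rewrite -subr_eq0 opprD addrA subrr add0r oppr_eq0 => /eqP.
  by apply/funext => k; rewrite !big_nil mulr0 addr0.
rewrite big_cons -IH -Llin; last 2 first.
- apply: (@inH_seq _ [:: kap i]) => k; rewrite inE /delta_seq.
  by move=> /negbTE ->.
- exact: inHs.
by congr L; apply/funext => k; rewrite big_cons.
Qed.

(** Bathtub principle: with threshold [tau], the largest [q] outside [A], each product $(q_i -
    \tau)(x_i - 1_{i \notin A})$ is nonnegative, and the total mass of [x] is at least that of the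
    indicator. *)
Lemma rearrangement (I : finType) (q x : I -> R) (A : {pred I}) (n : nat) :
  (forall i, 0 <= q i) -> (forall i, 0 <= x i <= 1) ->
  (forall i j, i \in A -> j \notin A -> q j <= q i) ->
  #|A| = n -> #|I|%:R - n%:R <= \sum_i x i ->
  \sum_(i | i \notin A) q i <= \sum_i q i * x i.
Proof.
move=> q0 x01 qA cA hx.
pose tau := \big[Order.max/0]_(i | i \notin A) q i.
have tau0 : 0 <= tau by exact: bigmax_ge_id.
have tauA i : i \in A -> tau <= q i.
  by move=> iA; apply: bigmax_le => // j jA; exact: qA.
have tauC i : i \notin A -> q i <= tau by move=> iA; exact: (le_bigmax_cond _ q iA).
rewrite big_mkcond /= -subr_ge0 -sumrB.
apply: (@le_trans _ _ (\sum_i tau * (x i - (i \notin A)%:R))).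
  have cnt : \sum_i (i \notin A)%:R = #|I|%:R - n%:R :> R.
    rewrite -cA -(cardC A) natrD addrAC subrr add0r -sum1_card natr_sum.
    by rewrite [RHS]big_mkcond; apply: eq_bigr => i _; rewrite !inE; case: (i \in A).
  by rewrite -mulr_sumr mulr_ge0// sumrB subr_ge0 cnt.
apply: ler_sum => i _; have /andP[xi0 xi1] := x01 i.
case: ifPn => [iA|]; last first.
  by rewrite negbK => iA; rewrite !subr0 ler_wpM2r// tauA.
rewrite /= -subr_ge0 (_ : _ - _ = (tau - q i) * (1 - x i)); last by ring.
by rewrite mulr_ge0// subr_ge0// tauC.
Qed.

End LowerBound.

(** * Fooling functions and the lower bound for arbitrary linear information *)

Section Fooling.
Variables (R : realType) (d : nat) (w : Zd d -> R).
Hypotheses (w_pos : forall k, 0 < w k)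
  (w_sum : (\esum_(k in [set: Zd d]) ((w k) ^-2)%:E < +oo)%E).

Lemma conjc_realM (a : R) (z : R[i]) : (a%:C%C * z^*%C)^*%C = a%:C%C * z.
Proof. by rewrite rmorphM; congr (_ * _); [exact: conjc_real|exact: conjcK]. Qed.

(** In the orthonormal basis $e_k/w(k)$, these are the coordinates of the representer of evaluation
    at [z / M], restricted to the frequencies [kap]. *)
Definition wave_vector N (kap : 'I_N -> Zd d) M (z : grid d M) : 'cV[R[i]]_N :=
  \col_j (((w (kap j))^-1)%:C%C * (cexp R (phase R d M (kap j) z))^*%C).

(** In the expanded quadratic form a cross term carries the character of the nonzero frequency
    [kap i - kap j], whose grid sum vanishes once [M] exceeds all the differences. The diagonal
    gives a weighted trace. *)
Lemma grid_average N (kap : 'I_N -> Zd d) (P : 'M[R[i]]_N) : injective kap ->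
  exists2 M, (0 < M)%N &
    \sum_(z : grid d M) (adjoint R N 1 (wave_vector N kap M z) *m P *m
       wave_vector N kap M z) 0 0 =
    (M ^ d)%:R * \sum_i (w (kap i) ^- 2)%:C%C * P i i.
Proof.
move=> kapI; pose dif (k l : Zd d) : Zd d := k - l.
pose B := (\sum_i \sum_j \sum_a `|dif (kap i) (kap j) a|)%N.
have leB i j a : (`|dif (kap i) (kap j) a| <= B)%N.
  by rewrite /B (bigD1 i)//= (bigD1 j)//= (bigD1 a)//= -!addnA leq_addr.
exists B.+1 => //.
have E z : (adjoint R N 1 (wave_vector N kap B.+1 z) *m P *m
       wave_vector N kap B.+1 z) 0 0 =
    \sum_j \sum_i (w (kap i))^-1%:C%C * (w (kap j))^-1%:C%C * P i j *
       cexp R (phase R d B.+1 (dif (kap i) (kap j)) z).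
  rewrite mxE; apply: eq_bigr => j _; rewrite mxE mulr_suml.
  apply: eq_bigr => i _; rewrite adjointE !mxE conjc_realM.
  rewrite /dif phaseB cexpD cexpN.
  by set u := cexp _ _; set v := cexp _ _; ring.
under eq_bigr do rewrite E.
rewrite exchange_big mulr_sumr /=; apply: eq_bigr => j _.
rewrite exchange_big (bigD1 j)//= [X in _ + X]big1 ?addr0.
  under eq_bigr => z _.
    rewrite (_ : phase _ _ _ _ z = 0) ?cexp0 ?mulr1; last first.
      by rewrite /dif phaseB subrr.
    over.
  rewrite sumr_const card_ffun !card_ord -[LHS]mulr_natl; congr (_ * (_ * _)).
  by rewrite -rmorphM /= -invfM -expr2.
move=> i ij; rewrite -mulr_sumr grid_orthogonality ?mulr0//.
- by rewrite /dif subr_eq0 (inj_eq kapI).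
- by move=> a; rewrite ltnS; exact: leB.
Qed.

(* The fooling function [sigma * P sigma e(-x)], normalised: it is annihilated
   by the functionals, and its value at [x] is the norm of [P sigma e(-x)]. *)
Lemma fooling_function n (L : 'I_n -> Seq R d -> R[i]) (s t : seq (Zd d)) :
  (forall i, Lam_all w (L i)) -> uniq (s ++ t) -> size s = n ->
  (forall k l, k \in s -> l \notin s -> w l ^- 2 <= w k ^- 2) ->
  exists c : Seq R d, exists x, [/\ unit_ball w c, forall i, L i c = 0, cube x,
    (exists J : seq (Zd d), forall k, k \notin J -> c k = 0)
    & \sum_(k <- t) w k ^- 2 <= cabs (fval c x) ^+ 2].
Proof.
move=> HL us ss top; set J := s ++ t in us.
pose N := size J; pose kap (i : 'I_N) := tnth (in_tuple J) i.
have kapI : injective kap by apply/tuple_uniqP.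
have sumJ (V : nmodType) (F : Zd d -> V) : \sum_(k <- J) F k = \sum_(i < N) F (kap i).
  exact: big_tnth.
pose sig i : R := (w (kap i))^-1.
(* The conjugate makes pairing with [lv i] reproduce [L i] in orthonormal coordinates; indices
   beyond [n] get the zero vector. *)
pose lv (a : nat) : 'cV[R[i]]_N := \col_j ((sig j)%:C%C *
  (if insub a is Some i then (L i (delta_seq R d (kap j)))^*%C else 0)).
have [P [Pa PP Pl Pt]] := annihilating_projection R N n lv.
have [M M0 avg] := grid_average N kap P kapI.
pose x i := complex.Re (P i i).
have Px i : P i i = (x i)%:C%C by exact: (projection_diag R N P i Pa PP).1.
have x01 i : 0 <= x i <= 1 by exact: (projection_diag R N P i Pa PP).2.
pose a z := P *m wave_vector N kap M z.
pose rho z := \sum_i cabs (a z i 0) ^+ 2.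
have rhoE z : (adjoint R N 1 (wave_vector N kap M z) *m P *m
    wave_vector N kap M z) 0 0 = (rho z)%:C%C.
  by rewrite -adjoint_mul_self /a adjointM Pa !mulmxA -(mulmxA _ P P) PP.
set tau := \sum_(k <- t) _.
have tauE : tau = \sum_(i | i \notin [pred i | kap i \in s]) w (kap i) ^- 2.
  rewrite big_mkcond -(sumJ _ (fun k => if k \notin s then w k ^- 2 else 0)) /J.
  rewrite big_cat /= big1_seq ?add0r; last by move=> k /andP[_ ->].
  rewrite /tau big_seq [RHS]big_seq; apply: eq_bigr => k kt.
  move: us; rewrite cat_uniq => /and3P[_ /hasPn h _].
  by rewrite (h k kt).
have tau_le : tau <= \sum_i w (kap i) ^- 2 * x i.
  rewrite tauE; apply: (rearrangement _ _ _ _ _ n) => //.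
  - by move=> i; rewrite invr_ge0 sqr_ge0.
  - by move=> i j; exact: top.
  - rewrite -ss -sum1_card big_mkcond /= -(sumJ _ (fun k => if k \in s then 1 else 0)%N).
    rewrite /J big_cat /= [X in _ + X]big1_seq ?addr0.
      by rewrite -sum1_size big_seq [RHS]big_seq; apply: eq_bigr => k ->.
    move=> k /andP[_ kt]; move: us; rewrite cat_uniq => /and3P[_ /hasPn h _].
    by rewrite (negbTE (h k kt)).
  - rewrite card_ord; apply: le_trans Pt _.
    rewrite /mxtrace; under eq_bigr do rewrite Px.
    by rewrite -rmorph_sum.
have sumrho : \sum_z rho z = (M ^ d)%:R * \sum_i w (kap i) ^- 2 * x i.
  apply: (@complexI R); rewrite rmorph_sum rmorphM rmorph_nat rmorph_sum /=.
  rewrite (eq_bigr _ (fun z _ => rhoE z)) in avg.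
  rewrite avg; congr (_ * _); apply: eq_bigr => i _; rewrite Px.
  by rewrite -rmorphM.
(* The grid mean of [rho] is at least [tau], so some value is. *)
have [z hz] : exists z, tau <= rho z.
  apply: contrapT => /forallNP h.
  have : \sum_(z : grid d M) rho z < \sum_(z : grid d M) tau.
    apply: ltr_sum => [|z _]; last by rewrite ltNge; apply/negP/h.
    by apply/hasP; exists [ffun=> Ordinal M0]; rewrite ?mem_index_enum.
  rewrite sumrho sumr_const card_ffun !card_ord -[ltRHS]mulr_natl.
  by rewrite ltr_pM2l ?ltr0n ?expn_gt0 ?M0// ltNge tau_le.
have rho0 : 0 <= rho z by apply: sumr_ge0 => i _; exact: sqr_ge0.
(* If [rho z = 0], the inverse is 0 by convention and [c] is the zero family, which still satisfies
   all the claims. *)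
pose r := (Num.sqrt (rho z))^-1.
have r0 : 0 <= r by rewrite invr_ge0 sqrtr_ge0.
pose b i := (sig i)%:C%C * (r%:C%C * a z i 0).
pose c : Seq R d := fun k => \sum_i b i * delta_seq R d (kap i) k.
have c_out k : k \notin J -> c k = 0.
  move=> kJ; apply: big1 => i _; rewrite /delta_seq; case: eqP => [ki|_].
    by move: kJ; rewrite ki /kap mem_tnth.
  by rewrite mulr0.
have c_in i : c (kap i) = b i.
  rewrite /c (bigD1 i)//= /delta_seq eqxx mulr1 big1 ?addr0// => j ji.
  by rewrite (inj_eq kapI) eq_sym (negbTE ji) mulr0.
exists c, (gridpt R d M z 1); split.
- rewrite /unit_ball /=.
  rewrite [Hnorm2 _ _](esumr_seq R _ (fun k => cabs (c k) ^+ 2 * w k ^+ 2) J)//; last 2 first.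
  + by move=> k; rewrite mulr_ge0 ?sqr_ge0.
  + by move=> k /c_out ->; rewrite cabs0 expr0n mul0r.
  rewrite lee_fin sumJ (_ : \sum_(i < N) _ = r ^+ 2 * rho z).
    have [->|rn0] := eqVneq (rho z) 0; first by rewrite mulr0.
    by rewrite /r exprVn sqr_sqrtr// mulVf.
  rewrite mulr_sumr; apply: eq_bigr => i _; rewrite c_in /b !cabsM !cabs_real.
  rewrite !ger0_norm//; last by rewrite invr_ge0 ltW.
  by rewrite /sig; field; rewrite gt_eqF.
- move=> i; rewrite /c (Lam_all_sum R d w)//.
  (* As [P] is self-adjoint it can be moved onto [lv i], which it annihilates. *)
  have adl : (adjoint R N 1 (lv i) *m a z) 0 0 = 0.
    by rewrite /a mulmxA -{1}Pa -adjointM Pl// !mxE big1// => j _; rewrite adjointE !mxE conjc0 mul0r.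
  rewrite (_ : \sum_(j < N) _ = r%:C%C * (adjoint R N 1 (lv i) *m a z) 0 0).
    by rewrite adl mulr0.
  rewrite mxE mulr_sumr; apply: eq_bigr => j _; rewrite adjointE [lv i _ _]mxE valK.
  rewrite conjc_realM /b; move: (a z j 0) (L i _) => u v.
  by ring.
- exact: gridpt_cube.
- by exists J.
- suff -> : fval c (gridpt R d M z 1) = (Num.sqrt (rho z))%:C%C.
    by rewrite cabs_real ger0_norm ?sqrtr_ge0// sqr_sqrtr.
  have rr : r * rho z = Num.sqrt (rho z).
    have [->|rn0] := eqVneq (rho z) 0; first by rewrite mulr0 sqrtr0.
    rewrite /r -{2}(sqr_sqrtr rho0) expr2 mulKf// sqrtr_eq0 -ltNge.
    by rewrite lt_neqAle eq_sym rn0.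
  rewrite -rr rmorphM /= -rhoE -mulmxA -/(a z) mxE mulr_sumr.
  rewrite /fval (csum_seq _ _ _ J)//; last by move=> k /c_out ->; rewrite mul0r.
  rewrite sumJ; apply: eq_bigr => i _; rewrite c_in ebasis_gridpt mul1r.
  rewrite adjointE [wave_vector _ _ _ _ _ _]mxE conjc_realM /b /sig.
  by set u := cexp _ _; set v := a z i 0; ring.
Qed.

(** A fooling function and its negative yield the same data, hence the same output, and one of them
    is missed by at least its own size. Letting [t] range over all finite sets of frequencies
    recovers the full tail sum. *)
Lemma all_error_ge n (s : seq (Zd d)) : (0 < n)%N -> uniq s -> size s = n ->
  (forall k l, k \in s -> l \notin s -> w l ^- 2 <= w k ^- 2) ->
  ((tailrad R d w s)%:E <= nth_err n w (Lam_all w))%E.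
Proof.
move=> n0 us ss top; rewrite /nth_err ifF; last by apply/negbTE; rewrite -lt0n.
apply: le_ereal_inf_tmp => _ [L [phi [HL ->]]].
have key (t : seq (Zd d)) : uniq (s ++ t) ->
    exists2 f : R, \sum_(k <- t) w k ^- 2 <= f ^+ 2 & 0 <= f /\ (f%:E <= wc_err w L phi)%E.
  move=> ust; have [c [x [hc Lc cx [J cJ] ft]]] := fooling_function n L s t HL ust ss top.
  exists (cabs (fval c x)) => //; split; first exact: cabs_ge0.
  (* The negative of [c], written in the shape of the linearity hypothesis. *)
  pose c' : Seq R d := fun k => -1 * c k + 0.
  have cs : csumm R (Zd d) c by exact: csumm_seq cJ.
  have hc' : unit_ball w c'.
    rewrite /unit_ball /= /Hnorm2 (_ : (fun k => _) = fun k => (cabs (c k) ^+ 2 * w k ^+ 2)%:E) //.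
    by apply/funext => k; rewrite /c' addr0 mulN1r cabsN.
  have z0 : inH w (fun=> 0 : R[i]) by apply: (@inH_seq R d w _ [::]).
  have Lc' i : L i c' = 0.
    have L0 := Lam_all_sum R d w (L i) 'I_0 [::] (fun=> 0) (fun=> 0) (HL i).
    have Lz : L i (fun=> 0) = 0.
      move: L0; rewrite big_nil (_ : (fun k => _) = fun=> 0)//.
      by apply/funext => k; rewrite big_nil.
    have [Llin _] := HL i; rewrite /c' Llin//; last exact: (inH_seq R d w _ J).
    by rewrite Lc mulr0 add0r Lz.
  have fc' : fval c' x = - fval c x.
    have f0 : fval (fun=> 0 : R[i]) x = 0.
      rewrite /fval -[RHS](csum0 R (Zd d)); congr csum.
      by apply/funext => k; rewrite mul0r.
    rewrite /c' (fval_lin R d (-1) c (fun=> 0))//; first by rewrite f0 mulN1r addr0.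
    exact: (@csumm_seq R _ _ [::]).
  have Lz (e : Seq R d) : (forall i, L i e = 0) -> (fun i => L i e) = (fun=> 0).
    by move=> h; apply/funext.
  pose g := phi (fun=> 0) x.
  have val (e : Seq R d) : unit_ball w e -> (forall i, L i e = 0) ->
      ((cabs (fval e x - g))%:E <= wc_err w L phi)%E.
    move=> he /Lz Le; apply: (@le_trans _ _ (supnorm (fun y =>
        fval e y - phi (fun i => L i e) y))); last first.
      by apply: ereal_sup_ubound; exists e.
    by apply: ereal_sup_ubound; exists x; rewrite // Le.
  have h1 := val c hc Lc; have h2 := val c' hc' Lc'.
  have : cabs (fval c x) <= Num.max (cabs (fval c x - g)) (cabs (fval c' x - g)).
    have := cabsB R (fval c x - g) (fval c' x - g).
    rewrite opprB addrA subrK fc' opprK -mulr2n -mulr_natl cabsM cabs_nat.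
    by rewrite le_max; case: leP => //= h; lra.
  rewrite -lee_fin => /le_trans; apply.
  by rewrite EFin_max ge_max h1 h2.
(* The empty [t] shows that the worst-case error is nonnegative, so it may be squared when
   finite. *)
have [f0 _ [f00 hf0]] : exists2 f : R, \sum_(k <- [::]) w k ^- 2 <= f ^+ 2 &
   0 <= f /\ (f%:E <= wc_err w L phi)%E by apply: key; rewrite cats0.
move: key hf0; case: (wc_err w L phi) => [e| |] key hf0 //; last by rewrite leey.
rewrite lee_fin in hf0; have e0 : 0 <= e by exact: le_trans hf0.
rewrite lee_fin /tailrad -[leRHS]ger0_norm// -sqrtr_sqr ler_sqrt ?sqr_ge0//.
have q0 k : 0 <= (if k \in s then 0 else w k ^- 2).
  by case: ifP => // _; rewrite invr_ge0 sqr_ge0.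
rewrite -lee_fin tsumK//; last exact: summ_tail.
apply: esumr_le => t ut.
have [|f hf [f1 fe]] := key [seq k <- t | k \notin s].
  rewrite cat_uniq us filter_uniq// andbT /=; apply/hasPn => k.
  by rewrite mem_filter => /andP[].
apply: (@le_trans _ _ (f ^+ 2)).
  apply: le_trans hf; rewrite big_filter [leRHS]big_mkcond /=.
  by apply: ler_sum => k _; case: ifP.
by rewrite ler_sqr ?nnegrE.
Qed.

End Fooling.

(** * Information complexity and the equivalence of tractability notions *)

Section Complexity.
Variable R : realType.

(** A constant frequency whose entry exceeds the sum of all first coordinates in [s] is new; this
    needs at least one coordinate. *)
Lemma Zd_fresh d (s : seq (Zd d)) : (0 < d)%N -> exists k, k \notin s.
Proof.
case: d s => // d s _; pose B := (\sum_(l <- s) `|l ord0|)%N.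
exists [ffun=> B.+1%:Z]; apply/negP => h.
suff : (B.+1 <= B)%N by rewrite ltnn.
by rewrite {2}/B (big_rem _ h)/= ffunE leq_addr.
Qed.

Section FixedDimension.
Variables (d : nat) (w : Zd d -> R).
Hypotheses (d0 : (0 < d)%N) (w_pos : forall k, 0 < w k)
  (w_sum : (\esum_(k in [set: Zd d]) ((w k) ^-2)%:E < +oo)%E).

Lemma init_err_ge0 : (0 <= init_err w)%E.
Proof.
apply: (@le_trans _ _ (supnorm (fval (fun=> 0 : R[i]) : Pt R d -> _))).
  apply: (@le_trans _ _ (cabs (fval (fun=> 0 : R[i]) (fun=> 0 : R) : R[i]))%:E).
    by rewrite lee_fin cabs_ge0.
  by apply: ereal_sup_ubound; exists (fun=> 0) => // i; rewrite lexx ler01.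
apply: ereal_sup_ubound; exists (fun=> 0) => //.
rewrite /unit_ball /= [Hnorm2 _ _]esum1// => k _.
by rewrite cabs0 expr0n mul0r.
Qed.

Lemma all_error_le_std n : (nth_err n w (Lam_all w) <= nth_err n w (@Lam_std R d))%E.
Proof.
rewrite /nth_err; case: ifP => // _; apply: ereal_inf_le_tmp => _ [L [phi [HL ->]]].
exists L, phi; split => // i; apply: Lam_std_subset => //; exact: HL.
Qed.

(** Both errors are compared with [tailrad s], for [s] the [n] frequencies of smallest weight. At
    [n = 0] both are the initial error, which is nonnegative. *)
Lemma std_error_le_all n :
  (nth_err (20 * n ^ 3) w (@Lam_std R d) <= 20%:E * nth_err n w (Lam_all w))%E.
Proof.
have [->|n0] := posnP n.
  rewrite /nth_err /= -{1}[init_err w]mul1e lee_wpmul2r//.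
    exact: init_err_ge0.
  by rewrite lee_fin ler1n.
have [s [us ss top]] := largest_terms R (Zd d) (fun k => w k ^- 2)
  (fun s => Zd_fresh d s d0) (fun k => ltac:(by rewrite invr_gt0 exprn_gt0))
  (summ_winv2 R d w w_sum) n.
rewrite -{1}ss; apply: (@le_trans _ _ (20 * tailrad R d w s)%:E).
  by apply: std_error_le => //; rewrite ss.
by rewrite EFinM lee_wpmul2l// ?lee_fin//; exact: all_error_ge.
Qed.

Lemma nstar_le cr Lam (eps : R) n :
  (nth_err n w Lam <= eps%:E * CRI cr w)%E -> (nstar cr w Lam eps <= n%:R%:E)%E.
Proof. by move=> h; apply: ereal_inf_lbound; exists n. Qed.

(** The infimum over a nonempty set of naturals is attained, so a finite complexity comes with its
    error bound. *)
Lemma nstar_cases cr Lam (eps : R) : nstar cr w Lam eps = +oo%E \/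
  exists2 n, nstar cr w Lam eps = n%:R%:E & (nth_err n w Lam <= eps%:E * CRI cr w)%E.
Proof.
pose A n := `[< (nth_err n w Lam <= eps%:E * CRI cr w)%E >].
have [exA|noA] := pselect (exists n, A n); last first.
  left; rewrite /nstar (_ : [set _ | _ in _] = set0) ?ereal_inf0//.
  rewrite -subset0 => _ [n /= hn _]; apply: noA; exists n; exact/asboolP.
right; case: (ex_minnP exA) => n /asboolP An nmin; exists n => //.
apply/eqP; rewrite eq_le nstar_le//=; apply: le_ereal_inf_tmp => _ [m /= hm <-].
by rewrite lee_fin ler_nat; apply: nmin; exact/asboolP.
Qed.

(* Since [ln 0 = 0], the equivalence also covers [nstar = 0]. *)
Lemma quotient_leP cr Lam (eps Q delta : R) : 0 < Q ->
  ((`| lnE (nstar cr w Lam eps) * (Q^-1)%:E | <= delta%:E)%E <->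
   exists n, [/\ nstar cr w Lam eps = n%:R%:E,
     (nth_err n w Lam <= eps%:E * CRI cr w)%E & ln (n%:R : R) <= delta * Q]).
Proof.
move=> Q0; have lnn n : 0 <= ln (n%:R : R).
  by case: n => [|n]; [rewrite ln0|rewrite ln_ge0// ler1n].
have [->|[n -> hn]] := nstar_cases cr Lam eps.
  split=> [|[n []//]].
  by rewrite /= gt0_mulye ?lte_fin ?invr_gt0.
rewrite /= lee_fin normrM (ger0_norm (lnn n)) ger0_norm ?invr_ge0 ?(ltW Q0)//.
rewrite ler_pdivrMr//; split => [h|[m [[/eqP]]]]; first by exists n.
by rewrite eqr_nat => /eqP ->.
Qed.

End FixedDimension.

Lemma ln_nat_le (m n : nat) : (m <= n)%N -> ln (m%:R : R) <= ln n%:R.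
Proof.
case: m => [|m] mn; last first.
  by rewrite ler_ln ?posrE ?ltr0n ?ler_nat// (leq_trans _ mn).
by rewrite ln0//; case: n {mn} => [|n]; [rewrite ln0|rewrite ln_ge0// ler1n].
Qed.

Definition growth (s t eps : R) (d : nat) : R := (1 + ln eps^-1) `^ s + d%:R `^ t.

Lemma growth_gt0 s t eps d : 0 < eps < 1 -> 0 < growth s t eps d.
Proof.
move=> /andP[e0 e1]; apply: ltr_wpDr; rewrite ?powR_ge0// powR_gt0//.
by rewrite ltr_pwDl// ln_ge0// invf_ge1 // ltW.
Qed.

(** Either [eps^-1] or [d] must be large. This lets the denominator absorb the additive constant
    [ln 20]. *)
Lemma growth_unbounded (s t B : R) : 0 < s -> 0 < t -> exists N : R,
  forall (d : nat) (eps : R), 0 < eps < 1 -> N < eps^-1 + d%:R -> B <= growth s t eps d.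
Proof.
move=> s0 t0; pose A := Num.max B 0.
have A0 : 0 <= A by rewrite le_max lexx orbT.
have BA : B <= A by rewrite le_max lexx.
have root (r x : R) : 0 < r -> A `^ r^-1 <= x -> A <= x `^ r.
  move=> r0 h; have rn0 : r != 0 by rewrite gt_eqF.
  rewrite -[A]powRr1// -(mulVf rn0) powRrM.
  by apply: ge0_ler_powR; rewrite ?nnegrE ?powR_ge0 ?(ltW r0)// (le_trans _ h)// powR_ge0.
exists (sequences.expR (A `^ s^-1) + A `^ t^-1) => d eps e01 hN.
have e0 : 0 < eps by case/andP: e01.
apply: (le_trans BA); rewrite /growth.
have [h|h] := leP (sequences.expR (A `^ s^-1)) eps^-1.
  apply: ler_wpDr; rewrite ?powR_ge0//; apply: root => //.
  have : A `^ s^-1 <= ln eps^-1 by rewrite -exp.ler_expR lnK// posrE invr_gt0.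
  by lra.
apply: ler_wpDl; rewrite ?powR_ge0//; apply: root => //; lra.
Qed.

(** Indeed $1 + \ln(C/\varepsilon) \le (1+\ln C)(1+\ln\varepsilon^{-1})$, as both logarithms are
    nonnegative. *)
Lemma growth_scale (s t eps C : R) d : 0 < s -> 1 <= C -> 0 < eps < 1 ->
  growth s t (eps / C) d <= (1 + ln C) `^ s * growth s t eps d.
Proof.
move=> s0 C1 /andP[e0 e1]; have C0 : 0 < C by exact: lt_le_trans C1.
have lC : 0 <= ln C by exact: ln_ge0.
have le : 0 <= ln eps^-1 by rewrite ln_ge0// invf_ge1// ltW.
have c1 : 1 <= (1 + ln C) `^ s.
  rewrite -[X in X <= _](congr1 (fun f => f s) (powR1 R)); apply: ge0_ler_powR; rewrite ?nnegrE ?(ltW s0)//.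
  - by rewrite addr_ge0.
  - by rewrite lerDl.
rewrite /growth mulrDr; apply: lerD; last by rewrite ler_peMl// powR_ge0.
rewrite -powRM ?addr_ge0//; apply: ge0_ler_powR; rewrite ?nnegrE ?(ltW s0)//.
- rewrite addr_ge0// ln_ge0// invf_div ler_pdivlMr// mul1r.
  by rewrite (le_trans (ltW e1)).
- by rewrite mulr_ge0// addr_ge0.
- by rewrite invf_div lnM ?posrE ?invr_gt0//; nra.
Qed.

Lemma EXP_WT_st_iff (w : forall d : nat, Zd d -> R)
  (w_pos : forall (d : nat) (k : Zd d), (0 < d)%N -> 0 < w d k)
  (w_sum : forall d : nat, (0 < d)%N ->
     (\esum_(k in [set: Zd d]) ((w d k) ^-2)%:E < +oo)%E)
  (cr : crit) (s t : R) : 0 < s -> 0 < t ->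
  EXP_WT_st cr w (fun d => Lam_all (w d)) s t
  <-> EXP_WT_st cr w (fun d => @Lam_std R d) s t.
Proof.
move=> s0 t0; split=> H delta delta0; last first.
  have [N HN] := H delta delta0; exists N => d eps d0 e01 hN.
  have Q0 := growth_gt0 s t eps d e01.
  have /(quotient_leP _ _ _ _ _ _ _ Q0)[n [_ hn lnn]] := HN d eps d0 e01 hN.
  apply/(quotient_leP _ _ _ _ _ _ _ Q0).
  have le_n : (nth_err n (w d) (Lam_all (w d)) <= eps%:E * CRI cr (w d))%E.
    apply: le_trans hn; apply: all_error_le_std; [by move=> k; exact: w_pos|exact: w_sum].
  have := nstar_le _ _ _ _ _ _ le_n.
  have [->|[m -> hm]] := nstar_cases _ (w d) cr (Lam_all (w d)) eps; first by [].
  rewrite lee_fin ler_nat => mn; exists m; split=> //.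
  exact: le_trans (ln_nat_le _ _ mn) lnn.
pose c := (1 + ln 20) `^ s : R.
have c0 : 0 < c by rewrite powR_gt0// ltr_pwDl// ln_ge0// ler1n.
(* In $\ln(20n^3) = \ln 20 + 3\ln n$ each summand gets half of [delta]: the 6 accounts for this half
   and the cube, [c] for passing from [eps / 20] to [eps], and the next threshold for [ln 20]. *)
have [N HN] := H (delta / (6 * c)) ltac:(by rewrite divr_gt0// mulr_gt0).
have [N' HN'] := growth_unbounded s t (2 * ln 20 / delta) s0 t0.
exists (Num.max N N') => d eps d0 e01; rewrite gt_max => /andP[hN hN'].
have /andP[e0 e1] := e01.
have e'01 : 0 < eps / 20 < 1.
  by rewrite divr_gt0//= ltr_pdivrMr// mul1r (lt_trans e1)// ltr1n.
have hN2 : N < (eps / 20)^-1 + d%:R.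
  apply: (lt_le_trans hN); rewrite lerD2r invf_div ler_peMl ?ler1n//.
  by rewrite invr_ge0 ltW.
have Q0 := growth_gt0 s t eps d e01; have Q'0 := growth_gt0 s t (eps / 20) d e'01.
have /(quotient_leP _ _ _ _ _ _ _ Q'0)[n [_ hn lnn]] := HN d _ d0 e'01 hN2.
apply/(quotient_leP _ _ _ _ _ _ _ Q0).
have le_m : (nth_err (20 * n ^ 3) (w d) (@Lam_std R d) <= eps%:E * CRI cr (w d))%E.
  apply: (@le_trans _ _ (20%:E * nth_err n (w d) (Lam_all (w d)))%E).
    by apply: std_error_le_all => //; [move=> k; exact: w_pos|exact: w_sum].
  apply: (@le_trans _ _ (20%:E * ((eps / 20)%:E * CRI cr (w d)))%E).
    by rewrite lee_wpmul2l// lee_fin.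
  by rewrite muleA -EFinM mulrC divfK.
have := nstar_le _ _ _ _ _ _ le_m.
have [->|[m -> hm]] := nstar_cases _ (w d) cr (@Lam_std R d) eps; first by [].
rewrite lee_fin ler_nat => mn; exists m; split=> //.
apply: le_trans (ln_nat_le _ _ mn) _.
(* For [n = 0] the logarithm is 0 by convention; the product rule below needs a positive [n]. *)
have [->|n0] := posnP n; first by rewrite ln0// mulr_ge0// ltW.
have nR : 0 < n%:R :> R by rewrite ltr0n.
rewrite natrM natrX lnM ?posrE ?exprn_gt0// lnXn//.
have h1 := HN' d eps e01 hN'; rewrite ler_pdivrMr// in h1.
have h2 : delta / (6 * c) * growth s t (eps / 20) d <= delta / 6 * growth s t eps d.
  apply: (@le_trans _ _ (delta / (6 * c) * (c * growth s t eps d))).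
    rewrite ler_wpM2l//; last by apply: growth_scale => //; rewrite ler1n.
    by rewrite divr_ge0 ?mulr_ge0 ?ltW.
  rewrite le_eqVlt; apply/orP; left; apply/eqP; field.
  by rewrite gt_eqF.
by have := le_trans lnn h2; move: h1; lra.
Qed.

End Complexity.

Theorem theorem4p4 (R : realType) (w : forall d : nat, Zd d -> R)
  (w_pos : forall (d : nat) (k : Zd d), (0 < d)%N -> 0 < w d k)
  (w_sum : forall d : nat, (0 < d)%N ->
     (\esum_(k in [set: Zd d]) ((w d k) ^-2)%:E < +oo)%E)
  (cr : crit) :
  (forall s t : R, 0 < s -> 0 < t ->
     (EXP_WT_st cr w (fun d => Lam_all (w d)) s t
      <-> EXP_WT_st cr w (fun d => @Lam_std R d) s t))
  /\ (EXP_WT cr w (fun d => Lam_all (w d))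
      <-> EXP_WT cr w (fun d => @Lam_std R d)).
Proof.
split; first by move=> s t; exact: EXP_WT_st_iff.
by apply: EXP_WT_st_iff => //; exact: ltr01.
Qed.
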